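(* There is an algorithm that, given a graph $G$ with vertex set $[n]$, an interval biclique partition $\mathcal B$ of $G$, and a vertex $s$, computes in time $O((n+|\mathcal B|)\log n)$ the distance $d_G(s,v)$ for every vertex $v$ in the connected component of $s$, together with a shortest-path tree rooted at $s$ spanning that component.
   Context: An interval biclique partition of a graph $G$ with vertex set $[n]$ is a set $\mathcal B$ of pairs $(A,B)$, where $A,B$ are disjoint nonempty sets of consecutive integers (discrete intervals) of $[n]$, such that every pair $\{a,b\}$ with $a\in A$, $b\in B$ is an edge of $G$, and every edge of $G$ is of the form $\{a,b\}$ with $a\in A,b\in B$ for exactly one $(A,B)\in\mathcal B$. Graphs are unweighted; $d_G(s,v)$ is the number of edges of a shortest $s$–$v$ path. *)

(* Defs.v *)
From mathcomp Require Import all_boot.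
From Stdlib Require List.
Set Implicit Arguments. Unset Strict Implicit. Unset Printing Implicit Defensive.

Definition simple_graph_on (n : nat) (e : rel nat) : Prop :=
  (forall a b, e a b -> (1 <= a <= n) && (1 <= b <= n)) /\
  (forall a b, e a b = e b a) /\
  (forall a, ~~ e a a).

(* A biclique (A,B) with A = [alo, ahi], B = [blo, bhi] (discrete intervals). *)
Record ibic := IBic { alo : nat; ahi : nat; blo : nat; bhi : nat }.

Definition inI (lo hi x : nat) : bool := (lo <= x) && (x <= hi).

Definition ibic_wf (n : nat) (c : ibic) : Prop :=
  [&& 1 <= alo c, alo c <= ahi c, ahi c <= n,
      1 <= blo c, blo c <= bhi c & bhi c <= n] /\
  (forall x, ~~ (inI (alo c) (ahi c) x && inI (blo c) (bhi c) x)).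

Definition covers (c : ibic) (a b : nat) : bool :=
  (inI (alo c) (ahi c) a && inI (blo c) (bhi c) b) ||
  (inI (alo c) (ahi c) b && inI (blo c) (bhi c) a).

Definition interval_biclique_partition (n : nat) (e : rel nat) (bs : seq ibic) : Prop :=
  (forall c, Stdlib.Lists.List.In c bs -> ibic_wf n c) /\
  (forall c a b, Stdlib.Lists.List.In c bs -> inI (alo c) (ahi c) a -> inI (blo c) (bhi c) b -> e a b) /\
  (forall a b, e a b -> count (fun c => covers c a b) bs = 1).

Definition reachable (e : rel nat) (s v : nat) : Prop :=
  exists p : seq nat, path e s p /\ last s p = v.

Definition is_dist (e : rel nat) (s v k : nat) : Prop :=
  (exists p : seq nat, [/\ path e s p, last s p = v & size p = k]) /\
  (forall p : seq nat, path e s p -> last s p = v -> k <= size p).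

(* Machine model: a word RAM with direct and indirect addressing.      *)
(* Memory is nat -> nat; every value must stay below the word bound W  *)
(* (overflow makes the machine fail).                                  *)

Inductive instr :=
| IConst of nat & nat          (* IConst a v   : M[a] := v            *)
| IAdd of nat & nat & nat      (* IAdd a b c   : M[a] := M[b] + M[c]  *)
| ISub of nat & nat & nat      (* ISub a b c   : M[a] := M[b] - M[c] (truncated) *)
| IHalf of nat & nat           (* IHalf a b    : M[a] := M[b] / 2     *)
| ILoad of nat & nat           (* ILoad a b    : M[a] := M[M[b]]      *)
| IStore of nat & nat          (* IStore a b   : M[M[a]] := M[b]      *)
| IJlt of nat & nat & nat      (* IJlt a b l   : if M[a] < M[b] then goto l *)
| IHalt.

Definition program := seq instr.
Definition memory := nat -> nat.

Definition upd (M : memory) (a v : nat) : memory :=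
  fun x => if x == a then v else M x.

Definition config := (nat * memory)%type.

(* one step; None = failure (overflow, pc out of range, or halted) *)
Definition step (W : nat) (P : program) (cf : config) : option config :=
  let: (pc, M) := cf in
  let wr a v := if v < W then Some (pc.+1, upd M a v) else None in
  match nth IHalt P pc with
  | IConst a v => wr a v
  | IAdd a b c => wr a (M b + M c)
  | ISub a b c => wr a (M b - M c)
  | IHalf a b => wr a ((M b)./2)
  | ILoad a b => wr a (M (M b))
  | IStore a b => if M b < W then Some (pc.+1, upd M (M a) (M b)) else None
  | IJlt a b l => Some (if M a < M b then l else pc.+1, M)
  | IHalt => None
  end.

Fixpoint run (W : nat) (P : program) (k : nat) (cf : config) : option config :=
  if k is k'.+1 then
    match step W P cf with Some cf' => run W P k' cf' | None => None end
  else Some cf.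

Definition halted (P : program) (cf : config) : bool :=
  (cf.1 < size P) && (if nth IHalt P cf.1 is IHalt then true else false).

Definition halts_within (W : nat) (P : program) (M0 : memory) (t : nat)
    (M : memory) : Prop :=
  exists k cf, [/\ k <= t, run W P k (0, M0) = Some cf, halted P cf & cf.2 = M].

(* Input encoding: M[0] = n, M[1] = s, M[2] = |B|, M[3], M[4] = 0
   (reserved for output pointers), and biclique i occupies
   M[5+4i .. 5+4i+3] = alo, ahi, blo, bhi; all other cells are 0. *)
Definition input_mem (n s : nat) (bs : seq ibic) : memory :=
  fun x =>
    if x == 0 then n else if x == 1 then s else if x == 2 then size bs
    else if x < 5 then 0
    else let i := (x - 5) %/ 4 in
         if i < size bs then
           let c := nth (IBic 0 0 0 0) bs i in
           match (x - 5) %% 4 with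
           | 0 => alo c | 1 => ahi c | 2 => blo c | _ => bhi c end
         else 0.

(* Output specification: with D := M[3] and Par := M[4],
   - for every v in [n]: M[D+v] = d_G(s,v) + 1 if v is in the component of s,
     and M[D+v] = 0 otherwise;
   - for every v <> s in the component of s, p := M[Par+v] is the parent of v
     in a shortest-path (BFS) tree rooted at s: {p,v} is an edge and
     d_G(s,p) + 1 = d_G(s,v).  *)
Definition correct_output (n : nat) (e : rel nat) (s : nat) (M : memory) : Prop :=
  forall v, 1 <= v <= n ->
    (reachable e s v ->
       is_dist e s v (M (M 3 + v)).-1 /\ 0 < M (M 3 + v) /\
       (v != s -> e (M (M 4 + v)) v /\
                  is_dist e s (M (M 4 + v)) (M (M 3 + v)).-2)) /\
    (~ reachable e s v -> M (M 3 + v) = 0).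

(* Main.v *)
Require Import Defs.
From mathcomp Require Import all_boot.
From mathcomp Require Import zify.

Set Implicit Arguments.
Unset Strict Implicit.
Unset Printing Implicit Defensive.

(* Breadth-first search in which "enumerate the unvisited neighbours of v" is an
   exploration with persistent marks of an auxiliary digraph H having out-degree
   at most two. H consists of two copies of a segment tree on the vertices, one
   directed to the root and one directed to the leaves, and of two hubs per
   biclique (A, B): O(log n) nodes of the first copy, covering A, point to the
   hub of A, which points to O(log n) nodes of the second copy, covering B, and
   symmetrically. Then v and w are adjacent iff the first leaf of v reaches the
   second leaf of w in H. Since H has O((n + |B|) log n) nodes and each of them
   is explored once, this is also the running time. Arrays are kept apart in
   memory by interleaving them with stride 8. *)

(** * A structured language over the word RAM *)

(** Marks are never reset, since a fresh exploration per vertex would cost too much. This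
    persistence is correct because the marked set is closed under successors whenever an exploration
    ends: a second leaf behind a marked node is already visited, and breadth-first order bounds its
    distance by one more than that of the current vertex. Distances come from the queue, never from
    path lengths in [H]. That explorations reach neighbours only is shown without analysing paths:
    each node carries a label, a set of vertices that may reach it, and labels grow along arcs; at a
    node of the second copy, membership forces adjacency to all leaves below. Time is a counter in
    the state, so that one weakest-precondition calculus yields correctness, termination and cost
    together, and compilation multiplies the cost by a constant. Two bounds are kept apart: [V] on
    all program values, and a larger [W] on RAM words, which leaves room for interleaved
    addresses. *)

Inductive prim :=
| PConst of nat & nat
| PAdd of nat & nat & nat
| PSub of nat & nat & nat
| PHalf of nat & nat
| PLoad of nat & nat & nat
| PStore of nat & nat & nat
| PRawLoad of nat & nat
| PRawStore of nat & nat.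

Inductive cmd :=
| CPrim of prim
| CSeq of cmd & cmd
| CIf of nat & nat & cmd & cmd
| CWhile of nat & nat & cmd.

Coercion CPrim : prim >-> cmd.
Notation "c1 ;; c2" := (CSeq c1 c2) (at level 90, right associativity).

(* Banks 0-7 are conceptually unbounded arrays; bank 8 (the raw bank) is the
   window [41, B) of the RAM memory itself, hence its range condition in
   [prim_ok]. *)
Record state := State { reg : nat -> nat; bank : nat -> nat -> nat; ticks : nat }.

Definition tick (s : state) := State (reg s) (bank s) (ticks s).+1.
Definition set_reg (s : state) a v :=
  State (upd (reg s) a v) (bank s) (ticks s).+1.
Definition set_bank (s : state) i x v :=
  State (reg s) (fun j => if j == i then upd (bank s i) x v else bank s j)
        (ticks s).+1.

Definition prim_ok (V B : nat) (p : prim) (s : state) : Prop :=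
  match p with
  | PConst _ v => v < V
  | PAdd _ b c => reg s b + reg s c < V
  | PRawLoad _ x | PRawStore x _ => 41 <= reg s x < B
  | _ => True
  end.

Definition prim_eff (p : prim) (s : state) : state :=
  match p with
  | PConst a v => set_reg s a v
  | PAdd a b c => set_reg s a (reg s b + reg s c)
  | PSub a b c => set_reg s a (reg s b - reg s c)
  | PHalf a b => set_reg s a (reg s b)./2
  | PLoad i a x => set_reg s a (bank s i (reg s x))
  | PStore i x a => set_bank s i (reg s x) (reg s a)
  | PRawLoad a x => set_reg s a (bank s 8 (reg s x))
  | PRawStore x a => set_bank s 8 (reg s x) (reg s a)
  end.

(** The fuel [k] counts guard evaluations, and exhausted fuel is [False]: asking for some fuel in
    [wp] therefore asks for termination. *)
Fixpoint wp_loop (a b : nat) (body : (state -> Prop) -> state -> Prop)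
    (Q : state -> Prop) (k : nat) (s : state) : Prop :=
  if k is k'.+1 then
    if reg s a < reg s b then body (wp_loop a b body Q k') (tick s)
    else Q (tick s)
  else False.

Fixpoint wp (V B : nat) (c : cmd) (Q : state -> Prop) (s : state) : Prop :=
  match c with
  | CPrim p => prim_ok V B p s /\ Q (prim_eff p s)
  | CSeq c1 c2 => wp V B c1 (wp V B c2 Q) s
  | CIf a b c1 c2 => if reg s a < reg s b then wp V B c1 Q (tick s)
                     else wp V B c2 Q (tick s)
  | CWhile a b c1 => exists k, wp_loop a b (wp V B c1) Q k s
  end.

Lemma wp_loop_mono a b body (Q1 Q2 : state -> Prop) k s :
  (forall P1 P2 : state -> Prop, (forall s, P1 s -> P2 s) ->
     forall s, body P1 s -> body P2 s) ->
  (forall s, Q1 s -> Q2 s) -> wp_loop a b body Q1 k s -> wp_loop a b body Q2 k s.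
Proof.
move=> mono Q12; elim: k s => [//|k IH] s /=.
by case: ifP => _; [apply: mono | apply: Q12].
Qed.

Lemma wp_mono V B c (Q1 Q2 : state -> Prop) s :
  wp V B c Q1 s -> (forall s, Q1 s -> Q2 s) -> wp V B c Q2 s.
Proof.
move=> H Q12; elim: c Q1 Q2 Q12 s H => [p|c1 IH1 c2 IH2|a b c1 IH1 c2 IH2|a b c IH]
  Q1 Q2 Q12 s /=.
- by case=> ? ?; split=> //; apply: Q12.
- by apply: IH1 => s'; apply: IH2.
- by case: ifP => _; [apply: IH1 | apply: IH2].
- by case=> k H; exists k; apply: wp_loop_mono H => // P1 P2 P12 s'; apply: IH.
Qed.

(* The fuel needed is one more than the variant, but a decreasing variant may
   skip values, so fuel monotonicity is needed. *)
Lemma wp_loop_leq V B a b c Q k k' s : k <= k' ->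
  wp_loop a b (wp V B c) Q k s -> wp_loop a b (wp V B c) Q k' s.
Proof.
elim: k k' s => [//|k IH] [//|k'] s /= lekk'.
case: ifP => // _ H; apply: wp_mono H _ => s'; exact: IH.
Qed.

Lemma wp_seq V B c1 c2 (P Q : state -> Prop) s :
  wp V B c1 P s -> (forall s, P s -> wp V B c2 Q s) -> wp V B (c1;; c2) Q s.
Proof. exact: wp_mono. Qed.

Lemma wp_prim V B p c (Q : state -> Prop) s s' :
  prim_ok V B p s -> prim_eff p s = s' -> wp V B c Q s' -> wp V B (p;; c) Q s.
Proof. by move=> ? <-. Qed.

Lemma wp_seqE V B c1 c2 (Q : state -> Prop) s :
  wp V B (c1;; c2) Q s = wp V B c1 (wp V B c2 Q) s.
Proof. by []. Qed.

Lemma wp_ifE V B a b c1 c2 (Q : state -> Prop) s :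
  wp V B (CIf a b c1 c2) Q s =
  if reg s a < reg s b then wp V B c1 Q (tick s) else wp V B c2 Q (tick s).
Proof. by []. Qed.

Lemma wp_seqA V B c1 c2 c3 (Q : state -> Prop) s :
  wp V B ((c1;; c2);; c3) Q s = wp V B (c1;; c2;; c3) Q s.
Proof. by []. Qed.

(* Evaluating one instruction at a time keeps the symbolic state linear in the
   length of the code; [tac] rewrites with known register values. *)
Ltac wp_step tac :=
  rewrite ?wp_seqA; eapply wp_prim;
  [rewrite /= /upd /=; tac; try lia | rewrite /= /upd /=; tac; reflexivity |].

Lemma wp_while V B a b c (Q : state -> Prop) (I : nat -> state -> Prop) k s :
  (forall k s, I k s -> reg s a < reg s b ->
     wp V B c (fun s' => exists2 k', k' < k & I k' s') (tick s)) ->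
  (forall k s, I k s -> reg s b <= reg s a -> Q (tick s)) ->
  I k s -> wp V B (CWhile a b c) Q s.
Proof.
move=> Hstep Hend HI; exists k.+1.
have [m] := ubnP k; elim: m k s HI => // m IH k s HI lekm /=.
case: ltnP => Hab; last exact: Hend HI Hab.
apply: wp_mono (Hstep _ _ HI Hab) _ => s' [k' ltk' HI'].
apply: (@wp_loop_leq _ _ _ _ _ _ k'.+1) => //.
by apply: IH => //; apply: leq_trans ltk' _.
Qed.

(** * Compilation *)

(** The machine has no multiplication: three doublings give [8x], and cell [33 + i] holds the base
    [B + i] of bank [i]. Cell 32 is scratch. *)
Definition compile_addr (i x : nat) : program :=
  [:: IAdd 32 x x; IAdd 32 32 32; IAdd 32 32 32; IAdd 32 32 (33 + i)].

Definition compile_prim (p : prim) : program :=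
  match p with
  | PConst a v => [:: IConst a v]
  | PAdd a b c => [:: IAdd a b c]
  | PSub a b c => [:: ISub a b c]
  | PHalf a b => [:: IHalf a b]
  | PLoad i a x => rcons (compile_addr i x) (ILoad a 32)
  | PStore i x a => rcons (compile_addr i x) (IStore 32 a)
  | PRawLoad a x => [:: ILoad a x]
  | PRawStore x a => [:: IStore x a]
  end.

(** Independent of the code address, so that forward jump targets are known before the code they
    skip is emitted. *)
Fixpoint code_size (c : cmd) : nat :=
  match c with
  | CPrim p => size (compile_prim p)
  | CSeq c1 c2 => code_size c1 + code_size c2
  | CIf _ _ c1 c2 => (code_size c2 + code_size c1).+2
  | CWhile _ _ c => (code_size c).+3
  end.

(* RAM cells 30 and 31 hold 0 and 1, so [IJlt 30 31 l] is an unconditional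
   jump. *)
Fixpoint compile (pc : nat) (c : cmd) : program :=
  match c with
  | CPrim p => compile_prim p
  | CSeq c1 c2 => compile pc c1 ++ compile (pc + code_size c1) c2
  | CIf a b c1 c2 =>
      let l1 := pc + (code_size c2).+2 in
      IJlt a b l1 :: compile pc.+1 c2 ++
      IJlt 30 31 (l1 + code_size c1) :: compile l1 c1
  | CWhile a b c =>
      IJlt a b pc.+2 :: IJlt 30 31 (pc + (code_size c).+3) ::
      rcons (compile pc.+2 c) (IJlt 30 31 pc)
  end.

Definition prim_wf (p : prim) : bool :=
  match p with
  | PConst a _ => a < 30
  | PAdd a b c | PSub a b c => [&& a < 30, b < 30 & c < 30]
  | PHalf a b | PRawLoad a b | PRawStore a b => (a < 30) && (b < 30)
  | PLoad i a x | PStore i x a => [&& i < 8, a < 30 & x < 30]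
  end.

Fixpoint cmd_wf (c : cmd) : bool :=
  match c with
  | CPrim p => prim_wf p
  | CSeq c1 c2 => cmd_wf c1 && cmd_wf c2
  | CIf a b c1 c2 => [&& a < 30, b < 30, cmd_wf c1 & cmd_wf c2]
  | CWhile a b c => [&& a < 30, b < 30 & cmd_wf c]
  end.

Lemma size_compile pc c : size (compile pc c) = code_size c.
Proof.
elim: c pc => [p|c1 IH1 c2 IH2|a b c1 IH1 c2 IH2|a b c IH] pc //=.
- by rewrite size_cat IH1 IH2.
- by rewrite size_cat /= IH1 IH2; lia.
- by rewrite size_rcons IH.
Qed.

Definition code_at (P : program) (pc : nat) (code : program) : Prop :=
  forall j, j < size code -> nth IHalt P (pc + j) = nth IHalt code j.

Lemma code_at_cat P pc c1 c2 : code_at P pc (c1 ++ c2) ->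
  code_at P pc c1 /\ code_at P (pc + size c1) c2.
Proof.
move=> H; split=> j lt_j.
  by rewrite H ?nth_cat ?lt_j // size_cat; lia.
rewrite -addnA H ?size_cat ?ltn_add2l // nth_cat ltnNge leq_addr /=.
by rewrite addKn.
Qed.

Lemma code_at_cons P pc i c : code_at P pc (i :: c) ->
  nth IHalt P pc = i /\ code_at P pc.+1 c.
Proof.
move=> H; split=> [|j lt_j]; first by have := H 0 isT; rewrite addn0.
by rewrite addSnnS H.
Qed.

Lemma run_add W P k1 k2 cf cf1 cf2 :
  run W P k1 cf = Some cf1 -> run W P k2 cf1 = Some cf2 ->
  run W P (k1 + k2) cf = Some cf2.
Proof.
elim: k1 cf => [|k1 IH] cf /=; first by case=> ->.
by case: (step W P cf) => // cf'; apply: IH.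
Qed.

Lemma runS W P k cf cf1 cf2 :
  step W P cf = Some cf1 -> run W P k cf1 = Some cf2 ->
  run W P k.+1 cf = Some cf2.
Proof. by move=> /= ->. Qed.

(** Layout: registers in cells 0-29, jump constants in 30 and 31, unconstrained scratch in 32, bank
    bases in 33-40, the raw window up to [B], then the eight interleaved banks. Values below [V]
    keep every address [B + 8x + i] below [B + 8V + 8]. *)
Record sim (V B : nat) (M : memory) (s : state) : Prop := Sim {
  sim_reg : forall r, r < 30 -> M r = reg s r;
  sim_zero : M 30 = 0;
  sim_one : M 31 = 1;
  sim_base : forall i, i < 8 -> M (33 + i) = B + i;
  sim_bank : forall i x, i < 8 -> M (B + 8 * x + i) = bank s i x;
  sim_raw : forall x, 41 <= x < B -> M x = bank s 8 x;
  sim_reg_lt : forall r, r < 30 -> reg s r < V;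
  sim_bank_lt : forall i x, i < 8 -> bank s i x < V;
  sim_raw_lt : forall x, 41 <= x < B -> bank s 8 x < V
}.

Lemma sim_tick V B M s : sim V B M s -> sim V B M (tick s).
Proof. by case. Qed.

Lemma sim_set_reg V B M s a v : 41 <= B -> sim V B M s -> a < 30 -> v < V ->
  sim V B (upd M a v) (set_reg s a v).
Proof.
move=> ltB [Hr H0 H1 Hb Hbk Hraw Hr' Hbk' Hraw'] lta ltv.
split=> //= [r ltr||||i x lti|x ltx|r ltr]; rewrite /upd.
- by case: eqP => // _; apply: Hr.
- by case: eqP => [?|//]; lia.
- by case: eqP => [?|//]; lia.
- by move=> j ltj; rewrite -(Hb j) //; case: eqP => //; lia.
- by rewrite -Hbk //; case: eqP => //; lia.
- by rewrite -Hraw //; case: eqP => //; lia.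
- by case: eqP => // _; apply: Hr'.
Qed.

Lemma sim_set_bank V B M s i x v : 41 <= B -> sim V B M s -> i < 8 -> v < V ->
  sim V B (upd M (B + 8 * x + i) v) (set_bank s i x v).
Proof.
move=> ltB [Hr H0 H1 Hb Hbk Hraw Hr' Hbk' Hraw'] lti ltv.
split=> //= [r ltr||||j y ltj|y lty|j y ltj|y lty]; rewrite /upd.
- by rewrite -Hr //; case: eqP => //; lia.
- by case: eqP => [?|//]; lia.
- by case: eqP => [?|//]; lia.
- by move=> j ltj; rewrite -(Hb j) //; case: eqP => //; lia.
- case: (j =P i) => [->|neq]; first case: (y =P x) => [->|neq] /=.
  + by rewrite eqxx.
  + by rewrite -Hbk //; case: eqP => //; lia.
  + by rewrite /= -Hbk //; case: eqP => //; lia.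
- have -> : (8 == i) = false by lia.
  by rewrite -Hraw //; case: eqP => //; lia.
- case: eqP => _; last exact: Hbk'.
  by case: eqP => _; [|apply: Hbk'].

- have -> : (8 == i) = false by lia.
  exact: Hraw'.
Qed.

Lemma sim_set_raw V B M s x v : sim V B M s -> 41 <= x < B -> v < V ->
  sim V B (upd M x v) (set_bank s 8 x v).
Proof.
move=> [Hr H0 H1 Hb Hbk Hraw Hr' Hbk' Hraw'] ltx ltv.
split=> //= [r ltr||||j y ltj|y lty|j y ltj|y lty]; rewrite /upd.
- by rewrite -Hr //; case: eqP => //; lia.
- by case: eqP => [?|//]; lia.
- by case: eqP => [?|//]; lia.
- by move=> j ltj; rewrite -(Hb j) //; case: eqP => //; lia.
- have -> : (j == 8) = false by lia.
  by rewrite -Hbk //; case: eqP => //; lia.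
- by case: eqP => //= _; apply: Hraw.
- have -> : (j == 8) = false by lia.
  exact: Hbk'.
- by case: eqP => //= _; apply: Hraw'.
Qed.

Lemma run_compile_addr V B W P pc M s i x :
  B + 8 * V + 8 <= W -> 41 <= B ->
  code_at P pc (compile_addr i x) -> i < 8 -> x < 30 -> sim V B M s ->
  exists M', [/\ run W P 4 (pc, M) = Some (pc + 4, M'),
                 M' 32 = B + 8 * reg s x + i & sim V B M' s].
Proof.
move=> ltW ltB Hc lti ltx HS.
have Ex := sim_reg HS ltx; have ltV := sim_reg_lt HS ltx.
have Eb := sim_base HS lti.
move: Hc => /code_at_cons[H1] /code_at_cons[H2] /code_at_cons[H3].
case/code_at_cons=> H4 _.
pose M1 := upd M 32 (reg s x + reg s x).
pose M2 := upd M1 32 (M1 32 + M1 32).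
pose M3 := upd M2 32 (M2 32 + M2 32).
pose M4 := upd M3 32 (M3 32 + (B + i)).
have E1 : M1 32 = 2 * reg s x by rewrite /M1 /upd eqxx; lia.
have E2 : M2 32 = 4 * reg s x by rewrite /M2 /upd eqxx E1; lia.
have E3 : M3 32 = 8 * reg s x by rewrite /M3 /upd eqxx E2; lia.
have E4 : M4 32 = B + 8 * reg s x + i by rewrite /M4 /upd eqxx E3; lia.
have EM y : y <> 32 -> M4 y = M y.
  by move/eqP/negbTE=> ne; rewrite /M4 /M3 /M2 /M1 /upd ne.
exists M4; split=> //.
- apply: (@runS _ _ _ _ (pc.+1, M1)); first by rewrite /step H1 Ex ifT //; lia.
  apply: (@runS _ _ _ _ (pc.+2, M2)); first by rewrite /step H2 ifT //; lia.
  apply: (@runS _ _ _ _ (pc.+3, M3)); first by rewrite /step H3 ifT //; lia.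
  apply: (@runS _ _ _ _ (pc.+4, M4)); last by rewrite addn4.
  have Ebase : M3 (33 + i) = B + i.
    by rewrite -Eb /M3 /M2 /M1 /upd; case: eqP => //; lia.
  by rewrite /step H4 Ebase ifT //; lia.
- case: HS => Hr H0 H1' Hb Hbk Hraw Hr' Hbk' Hraw'.
  split=> // [r ltr|j y ltj|y lty].
  + by rewrite EM ?Hr //; lia.
  + by rewrite EM ?Hbk //; lia.
  + by rewrite EM ?Hraw //; lia.
Qed.

Lemma sim_prim V B W P pc M s p :
  B + 8 * V + 8 <= W -> 41 <= B -> 
  code_at P pc (compile_prim p) -> prim_wf p -> sim V B M s -> prim_ok V B p s ->
  exists M', run W P (size (compile_prim p)) (pc, M)
               = Some (pc + size (compile_prim p), M')
             /\ sim V B M' (prim_eff p s).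
Proof.
move=> ltW ltB; case: p => [a v|a b c|a b c|a b|i a x|i x a|a x|x a]
  /= Hc Hwf HS Hok.
- case/code_at_cons: Hc => H _; exists (upd M a v); rewrite /= H addn1 ifT; last lia.
  by split=> //; apply: sim_set_reg.
- case/code_at_cons: Hc => H _; case/and3P: Hwf => lta ltb ltc.
  exists (upd M a (reg s b + reg s c)).
  rewrite /= H addn1 !(sim_reg HS) // ifT; last lia.
  by split=> //; apply: sim_set_reg.
- case/code_at_cons: Hc => H _; case/and3P: Hwf => lta ltb ltc.
  have := sim_reg_lt HS ltb => ltV.
  exists (upd M a (reg s b - reg s c)).
  rewrite /= H addn1 !(sim_reg HS) // ifT; last lia.
  by split=> //; apply: sim_set_reg => //; lia.
- case/code_at_cons: Hc => H _; case/andP: Hwf => lta ltb.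
  have := sim_reg_lt HS ltb => ltV.
  exists (upd M a (reg s b)./2).
  rewrite /= H addn1 !(sim_reg HS) // ifT; last lia.
  by split=> //; apply: sim_set_reg => //; lia.
- case/and3P: Hwf => lti lta ltx.
  have [Hc1 Hc2] := @code_at_cat P pc (compile_addr i x) [:: ILoad a 32] Hc.
  case/code_at_cons: Hc2 => H5 _.
  have [M' [Hrun E32 HS']] := run_compile_addr ltW ltB Hc1 lti ltx HS.
  have ltv := sim_bank_lt HS (reg s x) lti.
  exists (upd M' a (bank s i (reg s x))); split; last exact: sim_set_reg.
  apply: (@run_add _ _ 4 1 _ _ _ Hrun); rewrite /= H5 E32 (sim_bank HS') //.
  by rewrite ifT ?[pc + 4]addn4 ?addn4 ?[pc + 5]addnS ?addn4 //; lia.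
- case/and3P: Hwf => lti lta ltx.
  have [Hc1 Hc2] := @code_at_cat P pc (compile_addr i x) [:: IStore 32 a] Hc.
  case/code_at_cons: Hc2 => H5 _.
  have [M' [Hrun E32 HS']] := run_compile_addr ltW ltB Hc1 lti ltx HS.
  have ltv := sim_reg_lt HS lta.
  exists (upd M' (B + 8 * reg s x + i) (reg s a)).
  split; last exact: sim_set_bank.
  apply: (@run_add _ _ 4 1 _ _ _ Hrun); rewrite /= H5 E32 (sim_reg HS') //.
  by rewrite ifT ?[pc + 4]addn4 ?addn4 ?[pc + 5]addnS ?addn4 //; lia.
- case/code_at_cons: Hc => H _; case/andP: Hwf => lta ltx.
  have ltv := sim_raw_lt HS Hok.
  exists (upd M a (bank s 8 (reg s x))).
  rewrite /= H addn1 (sim_reg HS ltx) (sim_raw HS Hok) ifT; last lia.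
  by split=> //; apply: sim_set_reg.
- case/code_at_cons: Hc => H _; case/andP: Hwf => ltx lta.
  have ltv := sim_reg_lt HS lta.
  exists (upd M (reg s x) (reg s a)).
  rewrite /= H addn1 !(sim_reg HS) // ifT; last lia.
  by split=> //; apply: sim_set_raw.
Qed.

Lemma size_compile_prim p : size (compile_prim p) <= 5.
Proof. by case: p. Qed.

Lemma ticks_prim p s : ticks (prim_eff p s) = (ticks s).+1.
Proof. by case: p. Qed.

(** Six RAM steps pay for a tick: a primitive compiles to at most five instructions, and a guard
    costs its test plus at most one jump. The additive form of the bound telescopes over sequences
    and iterations. *)
Lemma sim_cmd V B W P c pc M s (Q : state -> Prop) :
  B + 8 * V + 8 <= W -> 41 <= B ->
  code_at P pc (compile pc c) -> cmd_wf c -> sim V B M s -> wp V B c Q s ->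
  exists k M' s', [/\ run W P k (pc, M) = Some (pc + code_size c, M'),
    sim V B M' s', Q s' & k + 6 * ticks s <= 6 * ticks s'].
Proof.
move=> ltW ltB; have goto l pc' M0 s0 : nth IHalt P pc' = IJlt 30 31 l ->
    sim V B M0 s0 -> step W P (pc', M0) = Some (l, M0).
  by move=> H HS; rewrite /step H (sim_zero HS) (sim_one HS).
have test a b l pc' M0 s0 : nth IHalt P pc' = IJlt a b l -> a < 30 -> b < 30 ->
    sim V B M0 s0 ->
    step W P (pc', M0) = Some (if reg s0 a < reg s0 b then l else pc'.+1, M0).
  by move=> H lta ltb HS; rewrite /step H !(sim_reg HS).
elim: c pc M s Q => [p|c1 IH1 c2 IH2|a b c1 IH1 c2 IH2|a b c IH] pc M s Q /=.
- move=> Hc Hwf HS [Hok HQ].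
  have [M' [Hrun HS']] := sim_prim ltW ltB Hc Hwf HS Hok.
  exists (size (compile_prim p)), M', (prim_eff p s); split=> //.
  by rewrite ticks_prim; have := size_compile_prim p; lia.
- case/code_at_cat; rewrite size_compile => Hc1 Hc2 /andP[Hw1 Hw2] HS H.
  have [k1 [M1 [s1 [R1 S1 Q1 T1]]]] := IH1 _ _ _ _ Hc1 Hw1 HS H.
  have [k2 [M2 [s2 [R2 S2 Q2 T2]]]] := IH2 _ _ _ _ Hc2 Hw2 S1 Q1.
  exists (k1 + k2), M2, s2; split=> //; last lia.
  by apply: run_add R1 _; rewrite addnA.
- case/code_at_cons=> H1 /code_at_cat[Hc2].
  rewrite size_compile => /code_at_cons[H2 Hc1] /and4P[lta ltb Hw1 Hw2] HS.
  have Ht := test _ _ _ _ _ _ H1 lta ltb HS.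
  case: (reg s a < reg s b) Ht => Ht H.
    have E : (pc.+1 + code_size c2).+1 = pc + (code_size c2).+2 by lia.
    rewrite E in Hc1.
    have [k1 [M1 [s1 [R1 S1 Q1 T1]]]] := IH1 _ _ _ _ Hc1 Hw1 (sim_tick HS) H.
    exists k1.+1, M1, s1; split=> //; last by move: T1 => /=; lia.
    apply: runS Ht _; rewrite R1; congr (Some (_, _)); lia.
  have [k2 [M2 [s2 [R2 S2 Q2 T2]]]] := IH2 _ _ _ _ Hc2 Hw2 (sim_tick HS) H.
  exists (k2 + 1).+1, M2, s2; split=> //; last by move: T2 => /=; lia.
  apply: runS Ht _; apply: run_add R2 _.
  apply: runS (goto _ _ _ _ H2 S2) _ => /=; congr (Some (_, _)); lia.
- case/code_at_cons=> H1 /code_at_cons[H2].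
  rewrite -cats1 => /code_at_cat[Hc]; rewrite size_compile.
  case/code_at_cons=> H3 _ /and3P[lta ltb Hw] HS [j].
  elim: j M s HS => [//|j IHj] M s HS /=.
  have Ht := test _ _ _ _ _ _ H1 lta ltb HS.
  case: (reg s a < reg s b) Ht => Ht H; last first.
    exists 2, M, (tick s); split=> //; [|exact: sim_tick|rewrite /=; lia].
    by apply: runS Ht _; apply: runS (goto _ _ _ _ H2 HS) _.
  have [k1 [M1 [s1 [R1 S1 Q1 T1]]]] := IH _ _ _ _ Hc Hw (sim_tick HS) H.
  have [k2 [M2 [s2 [R2 S2 Q2 T2]]]] := IHj _ _ S1 Q1.
  exists (k1 + k2.+1).+1, M2, s2; split=> //; last by move: T1 => /=; lia.
  apply: runS Ht _; apply: run_add R1 _.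
  by apply: runS (goto _ _ _ _ H3 S1) _.
Qed.

(** * Binary digraphs given by two successor arrays *)

(* Successor 0 means that there is no successor. *)
Definition succ_closed (L R : nat -> nat) (P : nat -> Prop) : Prop :=
  forall x y, P x -> y <> 0 -> y = L x \/ y = R x -> P y.

(** An impredicative form of reachability, convenient because the search applies it to the set of
    marked nodes, which is closed once an exploration ends. *)
Definition gconn (L R : nat -> nat) (x y : nat) : Prop :=
  forall P, succ_closed L R P -> P x -> P y.

(** Weaker than inclusion of arcs: inserting a list cell subdivides an old arc [q -> R q], so only
    reachability survives. *)
Definition gext (L R L' R' : nat -> nat) : Prop :=
  forall P, succ_closed L' R' P -> succ_closed L R P.

Lemma gext_trans L1 R1 L2 R2 L3 R3 :
  gext L1 R1 L2 R2 -> gext L2 R2 L3 R3 -> gext L1 R1 L3 R3.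
Proof. by move=> H12 H23 P /H23/H12. Qed.

Lemma gconn_ext L R L' R' x y : gext L R L' R' -> gconn L R x y -> gconn L' R' x y.
Proof. by move=> H G P /H; apply: G. Qed.

Lemma gconn_trans L R x y z : gconn L R x y -> gconn L R y z -> gconn L R x z.
Proof. by move=> Hxy Hyz P HP Px; apply: Hyz => //; apply: Hxy. Qed.

Lemma gconn_step L R x y : y <> 0 -> y = L x \/ y = R x -> gconn L R x y.
Proof. by move=> y0 H P HP Px; apply: HP Px y0 H. Qed.

(* [F x] over-approximates the set of vertices from whose leaf [x] can be
   reached. *)
Record graph_ok (F : nat -> nat -> Prop) (fr : nat) (L R : nat -> nat) : Prop := {
  graph_lt : forall x, L x < fr /\ R x < fr;
  graph_fresh : forall x, fr <= x -> L x = 0 /\ R x = 0;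
  graph_sound : forall u, succ_closed L R (F^~ u)
}.

(** By [graph_lt] no arc enters the node [fr], and by [graph_fresh] none leaves it, so its label can
    be chosen freely. *)
Lemma graph_ok_alloc F fr L R (A : nat -> Prop) :
  graph_ok F fr L R ->
  graph_ok (fun x => if x == fr then A else F x) fr.+1 L R.
Proof.
case=> Hlt Hfr Hs; split=> [x|x ltx|u x y].
- by have [] := Hlt x; lia.
- by apply: Hfr; lia.
- have [L_lt R_lt] := Hlt x.
  move=> + y0 Hy; have -> : (y == fr) = false by case: Hy => ->; lia.
  case: eqP => [Ex|_ HF]; last exact: (Hs u x y HF).
  by have [] := Hfr x; rewrite ?Ex // -Ex => EL ER; case: Hy => E; rewrite E ?EL ?ER in y0.
Qed.

(* The edge q -> p is realized by a fresh list cell c = fr: q -> c -> p, where c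
   also leads to the former list of q. *)
Lemma graph_ok_add_edge F fr L R q p :
  graph_ok F fr L R -> 0 < fr -> q < fr -> 0 < p < fr ->
  (forall u, F q u -> F p u) ->
  let L' := upd L fr p in
  let R' := upd (upd R fr (R q)) q fr in
  [/\ graph_ok (fun x => if x == fr then F q else F x) fr.+1 L' R',
      gext L R L' R' & gconn L' R' q p].
Proof.
case=> Hlt Hfr Hs fr0 ltq ltp HF L' R'.
have neq : (fr == q) = false by lia.
have EL' : L' fr = p by rewrite /L' /upd eqxx.
have ER' : R' fr = R q by rewrite /R' /upd neq eqxx.
have Eq' : R' q = fr by rewrite /R' /upd eqxx.
have EL x : x <> fr -> L' x = L x by rewrite /L' /upd; case: eqP.
have ER x : x <> fr -> x <> q -> R' x = R x.
  by rewrite /R' /upd; do 2 case: eqP => //.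
split.
- split=> [x|x ltx|u x y].
  + have [Lx Rx] := Hlt x; have [_ Rq] := Hlt q.
    by rewrite /L' /R' /upd; do ![case: eqP => _]; lia.
  + have [EL0 ER0] := Hfr x (ltnW ltx).
    by rewrite EL ?ER //; lia.
  + have [Lx Rx] := Hlt x; have [Lq Rq] := Hlt q.
    move=> + y0; case: (x =P fr) => [->|nx].
      rewrite EL' ER' => Fq [E|E]; rewrite E.
        by rewrite ifN; [apply: HF|lia].
      rewrite ifN; last lia.
      by rewrite E in y0; apply: (Hs u q _ Fq y0); right.
    rewrite EL // => Fx; case=> E.
      rewrite E ifN; last lia.
      by rewrite E in y0; apply: (Hs u x _ Fx y0); left.
    case: (x =P q) => [Exq|nxq].
      by rewrite E Exq Eq' eqxx -Exq.
    rewrite ER // in E; rewrite E ifN; last lia.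
    by rewrite E in y0; apply: (Hs u x _ Fx y0); right.
- move=> P HP x y Px y0; have [Lx Rx] := Hlt x.
  case: (x =P fr) => [Ex|nx].
    by have [] := Hfr x; rewrite ?Ex // -Ex => -> ->; case.
  case=> E; first by apply: HP Px y0 _; left; rewrite EL.
  case: (x =P q) => [Exq|nxq]; last by apply: HP Px y0 _; right; rewrite ER.
  have Pfr : P fr by apply: (HP x) => //; [lia | right; rewrite Exq Eq'].
  by apply: (HP fr) => //; right; rewrite ER' -Exq.
- apply: (@gconn_trans _ _ _ fr).
    by apply: gconn_step; [lia|right].
  by apply: gconn_step; [lia|left].
Qed.

(** * Segment trees *)

(** Heap numbering, the parent of [x] being [x./2]. Iteration also reaches 0, which is no tree node;
    hence the conditions [0 < z] below. *)
Definition anc (z x : nat) : Prop := exists i, z = iter i half x.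

Lemma anc_refl x : anc x x. Proof. by exists 0. Qed.

Lemma anc_half z x : anc z x -> anc z./2 x.
Proof. by case=> i ->; exists i.+1. Qed.

Lemma anc_inv z x : anc z x -> z = x \/ exists2 y, z = y./2 & anc y x.
Proof. by case=> -[|i] E; [left | right; exists (iter i half x); [|exists i]]. Qed.

Lemma anc_leq z x : anc z x -> z <= x.
Proof. by case=> i; elim: i z => [|i IH] z -> //=; have := IH _ erefl; lia. Qed.

(* Leaves of the tree are the nodes N + v with v < N. *)
Lemma anc_leaf N z w : w < N -> N <= z -> anc z (N + w) -> z = N + w.
Proof. by move=> ltw lez /anc_inv[//|[y Ey /anc_leq]]; lia. Qed.

(** With [z = x - 2N], the value [x + (x - 2N)] is [2N + 2z], the copy of the child [2z]. [N] need
    not be a power of two. *)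
Definition tree_left (N x : nat) : nat :=
  if x < 2 * N then x./2 else if x < 3 * N then x + (x - 2 * N) else 0.
Definition tree_right (N x : nat) : nat :=
  if 2 * N <= x < 3 * N then (x + (x - 2 * N)).+1 else 0.

(* Node x < 2N is the tree node x directed to the root, node 2N + x its copy
   directed to the leaves. *)
Definition tree_label (N : nat) (e : rel nat) (x u : nat) : Prop :=
  if x < 2 * N then u < N /\ anc x (N + u)
  else forall w, w < N -> anc (x - 2 * N) (N + w) -> e u w.

Definition tree_conn (N : nat) (L R : nat -> nat) : Prop :=
  forall z w, w < N -> 0 < z -> anc z (N + w) ->
    gconn L R (N + w) z /\ gconn L R (2 * N + z) (3 * N + w).

Lemma tree_conn_ext N L R L' R' :
  gext L R L' R' -> tree_conn N L R -> tree_conn N L' R'.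
Proof.
move=> HE H z w ltw z0 Hz; have [H1 H2] := H z w ltw z0 Hz.
by split; apply: gconn_ext HE _.
Qed.

Lemma tree_graph_ok N e L R : 0 < N -> L =1 tree_left N -> R =1 tree_right N ->
  graph_ok (tree_label N e) (4 * N) L R.
Proof.
move=> N0 EL ER; split=> [x|x lex|u x y]; rewrite ?EL ?ER.
- by rewrite /tree_left /tree_right; split; do ![case: ifP]; lia.
- by rewrite /tree_left /tree_right; split; do ![case: ifP]; lia.
- rewrite /tree_left /tree_right /tree_label.
  case: (ltnP x (2 * N)) => Hx /= HF y0.
    case=> // ->; rewrite ifT; last lia.
    by case: HF => ? /anc_half.
  case: ifP => Hx3; last by case.
  move=> Hy; rewrite ifN; last by case: Hy => ->; lia.
  move=> w ltw /anc_half Hw; apply: HF => //.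
  by rewrite (_ : x - 2 * N = (y - 2 * N)./2) //; case: Hy => ->; lia.
Qed.

(** One induction on the number of halvings prolongs the upward path at its end and the downward
    path at its start. *)
Lemma tree_graph_conn N L R : L =1 tree_left N -> R =1 tree_right N ->
  tree_conn N L R.
Proof.
move=> EL ER z w ltw z0 [i Ez]; elim: i z Ez z0 => [|i IH] z Ez z0.
  rewrite Ez /=; split=> [P _ //|]; rewrite (_ : 2 * N + (N + w) = 3 * N + w) //.
  lia.
rewrite iterS in Ez; set z' := iter i half (N + w) in Ez IH.
have z'0 : 0 < z' by lia.
have ltz' : z' <= N + w by apply: anc_leq; exists i.
have [H1 H2] := IH z' erefl z'0.
split.
  apply: gconn_trans H1 _; apply: gconn_step; first lia.
  by left; rewrite EL /tree_left ifT //; lia.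
apply: gconn_trans H2; apply: gconn_step; first lia.
rewrite EL ER /tree_left /tree_right ifN; last lia.
rewrite !ifT; lia.
Qed.

(** * Bottom-up interval decomposition *)

(** Once both ends are even, the children of [[l'./2, r'./2)] are exactly [[l', r')], so a leaf
    below a halved node lies below a node of the old range. *)
Lemma decomp_sound_half N lo hi l r l' r' :
  r <= 2 * N -> l <= l' -> r' <= r -> ~~ odd l' -> ~~ odd r' ->
  (forall z, l <= z < r -> forall w, w < N -> anc z (N + w) -> lo <= w <= hi) ->
  forall z, l'./2 <= z < r'./2 -> forall w, w < N -> anc z (N + w) -> lo <= w <= hi.
Proof.
move=> ler lel ler' ol or H z Hz w ltw /anc_inv[E|[y Ey Hy]]; first lia.
by apply: (H y) => //; lia.
Qed.

(** [D w] stands for: [w] is already linked to the hubs. A node that halving loses is an odd end of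
    the range, and those have been emitted before. *)
Lemma decomp_complete_half N (D : nat -> Prop) l r l' r' w :
  l <= l' <= l.+1 -> r' <= r <= r'.+1 -> ~~ odd l' -> ~~ odd r' ->
  (forall z, l <= z < l' -> anc z (N + w) -> D w) ->
  (forall z, r' <= z < r -> anc z (N + w) -> D w) ->
  (D w \/ exists2 z, l <= z < r & anc z (N + w)) ->
  D w \/ exists2 z, l'./2 <= z < r'./2 & anc z (N + w).
Proof.
move=> Hl Hr ol or Dl Dr [|[z Hz Az]]; first by left.
case: (ltnP z l') => H1; first by left; apply: (Dl z) => //; lia.
case: (leqP r' z) => H2; first by left; apply: (Dr z) => //; lia.
by right; exists z./2; [lia | apply: anc_half].
Qed.

Definition frame (rs bs : seq nat) (s s' : state) : Prop :=
  (forall r, r \notin rs -> reg s' r = reg s r) /\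
  (forall i, i \notin bs -> bank s' i = bank s i).

Lemma frame_trans rs bs s1 s2 s3 :
  frame rs bs s1 s2 -> frame rs bs s2 s3 -> frame rs bs s1 s3.
Proof.
move=> [R1 B1] [R2 B2]; split=> x Hx; first by rewrite R2 ?R1.
by rewrite B2 ?B1.
Qed.

Lemma frame_sub rs bs rs' bs' s s' : subseq rs rs' -> subseq bs bs' ->
  frame rs bs s s' -> frame rs' bs' s s'.
Proof.
move=> Hrs Hbs [R1 B1]; split=> x Hx.
  by apply: R1; apply: contra Hx => /(mem_subseq Hrs).
by apply: B1; apply: contra Hx => /(mem_subseq Hbs).
Qed.

Ltac solve_frame :=
  split=> ?; rewrite ?inE /= /upd; do ?[case: eqP => //= ?].

(** * Edge insertion *)

(* Registers: 0 n, 1 s, 2 |B|, 3 D, 4 Par, 5-8 N 2N 3N 4N with N = n+1,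
   9 next fresh node, 26 one, 27 zero; the others are local.
   Banks: 0 input, 1 and 2 successors L and R, 3 marks, 4 queue, 5 stack,
   8 raw memory. *)

(* Adds the edges z -> h and h' -> 2N + z, for z, h, h' in registers
   17, 14, 15. *)
Definition add_edges : cmd :=
  PStore 1 9 14;; PLoad 2 16 17;; PStore 2 9 16;; PStore 2 17 9;;
  PAdd 9 9 26;; PAdd 18 6 17;;
  PStore 1 9 18;; PLoad 2 16 15;; PStore 2 9 16;; PStore 2 15 9;;
  PAdd 9 9 26.

Record graph_step (F : nat -> nat -> Prop) (s : state)
    (F' : nat -> nat -> Prop) (s' : state) : Prop := {
  step_ok : graph_ok F' (reg s' 9) (bank s' 1) (bank s' 2);
  step_ext : gext (bank s 1) (bank s 2) (bank s' 1) (bank s' 2);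
  step_label : forall x, x < reg s 9 -> F' x = F x;
  step_fresh : reg s 9 <= reg s' 9
}.

Lemma graph_step_refl F s :
  graph_ok F (reg s 9) (bank s 1) (bank s 2) -> graph_step F s F s.
Proof. by move=> H; split=> // P. Qed.

Lemma graph_step_trans F1 s1 F2 s2 F3 s3 :
  graph_step F1 s1 F2 s2 -> graph_step F2 s2 F3 s3 -> graph_step F1 s1 F3 s3.
Proof.
move=> [O1 E1 L1 f1] [O2 E2 L2 f2]; split=> //.
- exact: gext_trans E1 E2.
- by move=> x ltx; rewrite L2 ?L1 //; lia.
- lia.
Qed.

Lemma graph_step_frame F s rs bs F1 s1 s2 : frame rs bs s1 s2 ->
  9 \notin rs -> 1 \notin bs -> 2 \notin bs ->
  graph_step F s F1 s1 -> graph_step F s F1 s2.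
Proof.
move=> [Hr Hb] n9 n1 n2 [ok ext lab le].
by split; rewrite ?(Hr 9 n9) ?(Hb 1 n1) ?(Hb 2 n2).
Qed.

Lemma wp_add_edges V B N F s (Q : state -> Prop) :
  let z := reg s 17 in let h := reg s 14 in let h' := reg s 15 in
  let fr := reg s 9 in
  reg s 26 = 1 -> reg s 6 = 2 * N ->
  graph_ok F fr (bank s 1) (bank s 2) ->
  0 < z < 2 * N -> 4 * N <= fr -> 0 < h < fr -> 0 < h' < fr -> fr.+2 < V ->
  (forall u, F z u -> F h u) -> (forall u, F h' u -> F (2 * N + z) u) ->
  (forall s' F', graph_step F s F' s' ->
     gconn (bank s' 1) (bank s' 2) z h ->
     gconn (bank s' 1) (bank s' 2) h' (2 * N + z) ->
     reg s' 9 = fr.+2 -> frame [:: 9; 16; 18] [:: 1; 2] s s' ->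
     ticks s' = ticks s + 11 -> Q s') ->
  wp V B add_edges Q s.
Proof.
move=> z h h' fr E26 E6 Hok Hz Hfr Hh Hh' HV Fzh Fhz HQ.
have fr0 : 0 < fr by lia.
have ltz : z < fr by lia.
have [] := graph_ok_add_edge Hok fr0 ltz Hh Fzh.
set L1 := upd _ fr h; set R1 := upd _ z fr => Hok1 Hext1 Hc1.
have lth' : h' < fr.+1 by lia.
have Hz' : 0 < 2 * N + z < fr.+1 by lia.
have HF u : (if h' == fr then F z else F h') u ->
    (if 2 * N + z == fr then F z else F (2 * N + z)) u.
  by rewrite !ifN; [apply: Fhz|lia|lia].
have [] := graph_ok_add_edge Hok1 (ltn0Sn _) lth' Hz' HF.
set F2 := fun x => _.
set L2 := upd _ fr.+1 _; set R2 := upd _ h' _ => Hok2 Hext2 Hc2.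
rewrite /= /upd /= E26 E6 -/z -/h -/h' -/fr !addn1.
split=> //; split=> //; split=> //; split=> //; split; first lia.
split; first lia.
do 4 split=> //.
split; first lia.
apply: (HQ _ F2) => //=.
- split=> //=.
  + exact: gext_trans Hext1 Hext2.
  + by move=> x ltx; rewrite /F2 !ifN //; move: ltx; rewrite -/fr; lia.
  + by rewrite /upd /= -/fr; lia.
- exact: gconn_ext Hext2 Hc1.
- by solve_frame.
- lia.
Qed.

Opaque add_edges.

Definition nop : cmd := PSub 16 16 16.

(* Adds the edges z -> h and h' -> 2N + z for the nodes z of the decomposition
   of the leaves in [l, r), for l, r, h, h' in registers 12-15. *)
Definition decompose : cmd :=
  CWhile 12 13 (
    (PHalf 16 12;; PAdd 16 16 16;;
     CIf 16 12 (PAdd 17 12 27;; add_edges;; PAdd 12 12 26) nop);;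
    (PHalf 16 13;; PAdd 16 16 16;;
     CIf 16 13 (PSub 13 13 26;; PAdd 17 13 27;; add_edges) nop);;
    PHalf 12 12;; PHalf 13 13).

(** [dp_Fh] and [dp_Fh'] are what makes the new arcs sound: a leaf that reaches a node of the
    decomposition lies in [[lo, hi]] and may thus enter the hub in register 14, while whatever
    reaches the hub in register 15 is adjacent to all of [[lo, hi]]. *)
Record dec_pre N (e : rel nat) lo hi F s : Prop := {
  dp_one : reg s 26 = 1;
  dp_zero : reg s 27 = 0;
  dp_2N : reg s 6 = 2 * N;
  dp_ok : graph_ok F (reg s 9) (bank s 1) (bank s 2);
  dp_fr : 4 * N <= reg s 9;
  dp_h : 0 < reg s 14 < reg s 9;
  dp_h' : 0 < reg s 15 < reg s 9;
  dp_tree : tree_conn N (bank s 1) (bank s 2);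
  dp_label : forall x, x < 4 * N -> F x = tree_label N e x;
  dp_Fh : forall u, lo <= u <= hi -> F (reg s 14) u;
  dp_Fh' : forall u w, F (reg s 15) u -> lo <= w <= hi -> e u w
}.

Definition linked N s h h' w : Prop :=
  gconn (bank s 1) (bank s 2) (N + w) h /\
  gconn (bank s 1) (bank s 2) h' (3 * N + w).

Lemma linked_step N F s F' s' h h' w : graph_step F s F' s' ->
  linked N s h h' w -> linked N s' h h' w.
Proof. by case=> _ E _ _ [H H']; split; apply: gconn_ext E _. Qed.

Notation dec_regs := [:: 9; 12; 13; 16; 17; 18].

(* [s0] is the initial state; at most 4k + b node insertions remain. *)
Record dec_inv N (e : rel nat) lo hi k0 F0 s0 F s l r b k : Prop := {
  di_step : graph_step F0 s0 F s;
  di_frame : frame dec_regs [:: 1; 2] s0 s;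
  di_l : 0 < l;
  di_r : r <= 2 * N;
  di_fr : reg s 9 + 4 * k + b <= reg s0 9 + 4 * k0;
  di_sound : forall z, l <= z < r ->
    forall w, w < N -> anc z (N + w) -> lo <= w <= hi
}.

Lemma wp_emit V B N e lo hi k0 F0 s0 F s l r b k (Q : state -> Prop) :
  dec_pre N e lo hi F0 s0 -> reg s0 9 + 4 * k0 + 2 < V ->
  dec_inv N e lo hi k0 F0 s0 F s l r b.+2 k -> l <= reg s 17 < r ->
  (forall s' F', dec_inv N e lo hi k0 F0 s0 F' s' l r b k ->
     graph_step F s F' s' ->
     (forall w, w < N -> anc (reg s 17) (N + w) ->
        linked N s' (reg s0 14) (reg s0 15) w) ->
     frame [:: 9; 16; 18] [:: 1; 2] s s' -> ticks s' = ticks s + 11 -> Q s') ->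
  wp V B add_edges Q s.
Proof.
move=> Hpre HV [Hst Hfr l0 r2N Hb Hs] Hz HQ.
have [one zero twoN ok0 fr4 h0 h0' tree lab Fh Fh'] := Hpre.
have [okF ext labF frle] := Hst.
have [E14 E15] : reg s 14 = reg s0 14 /\ reg s 15 = reg s0 15 by split; apply Hfr.
have z2N : reg s 17 < 2 * N by lia.
apply: (@wp_add_edges _ _ N F) => //; rewrite ?E14 ?E15; try lia.
- by rewrite Hfr.1.
- by rewrite Hfr.1.
- move=> u; rewrite !labF; try lia.
  rewrite lab; last lia.
  by rewrite /tree_label z2N => -[ltu] Hu; apply/Fh/(Hs _ Hz).
- move=> u; rewrite !labF; try lia.
  rewrite (lab (2 * N + reg s 17)); last lia.
  rewrite /tree_label ifN; last lia.
  move=> Hu w ltw Hw; apply: Fh' Hu _; apply: (Hs (reg s 17)) => //.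
  by rewrite addKn in Hw.
move=> s' F' Hst' Hc Hc' E9 Hfr' Ht.
have Hst0 := graph_step_trans Hst Hst'.
apply: (HQ _ F' _ Hst' _ Hfr' Ht).
  split=> //; last by rewrite E9; lia.
  by apply: frame_trans Hfr _; apply: frame_sub Hfr'.
move=> w ltw Hw.
have z0 : 0 < reg s 17 by lia.
have [H1 H2] := tree_conn_ext (step_ext Hst0) tree ltw z0 Hw.
split; first exact: gconn_trans H1 Hc.
exact: gconn_trans Hc' H2.
Qed.

(** The invariant [r <= 2 ^ k], with [k] dropping at each level, allows at most [k0] levels. A level
    emits at most two nodes of two list cells each and takes at most 40 ticks, whence [4 * k0] and
    [40 * k0]. *)
Lemma wp_decompose V B N e lo hi k0 F0 s0 (Q : state -> Prop) :
  dec_pre N e lo hi F0 s0 -> reg s0 9 + 4 * k0 + 2 < V ->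
  0 < N -> hi < N -> reg s0 12 = N + lo -> reg s0 13 = (N + hi).+1 ->
  2 * N <= 2 ^ k0 ->
  (forall s F, graph_step F0 s0 F s -> frame dec_regs [:: 1; 2] s0 s ->
     (forall w, lo <= w <= hi -> linked N s (reg s0 14) (reg s0 15) w) ->
     reg s 9 <= reg s0 9 + 4 * k0 ->
     ticks s <= ticks s0 + 40 * k0 + 1 -> Q s) ->
  wp V B decompose Q s0.
Proof.
move=> Hpre HV N0 ltN E12 E13 lek HQ.
set h := reg s0 14; set h' := reg s0 15.
have [one zero twoN ok0 fr4 h0 h0' tree lab Fh Fh'] := Hpre.
pose I k s := exists F, [/\ dec_inv N e lo hi k0 F0 s0 F s (reg s 12) (reg s 13) 0 k,
  reg s 13 <= 2 ^ k,
  forall w, lo <= w <= hi -> linked N s h h' w \/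
    (exists2 z, reg s 12 <= z < reg s 13 & anc z (N + w)) &
  ticks s + 40 * k <= ticks s0 + 40 * k0].
apply: (@wp_while _ _ _ _ _ _ I k0); last first.
- have st0 := graph_step_refl ok0.
  exists F0; split=> //; last 2 first.
  + by rewrite E13; lia.
  + move=> w Hw; right; exists (N + w); last exact: anc_refl.
    by rewrite E12 E13; lia.
  split=> //; rewrite ?E12 ?E13; try lia.
  by move=> z Hz w ltw /anc_leaf; lia.
- move=> k s [F [[Hst Hfr l0 r2N Hb Hs] Hk Hc Ht]] Hlr.
  have Hst' : graph_step F0 s0 F (tick s) by case: Hst; split.
  apply: (HQ _ F Hst' Hfr) => //=.
  + by move=> w /Hc[//|[z]]; lia.
  + by lia.
  + by lia.
move=> k s [F [Hinv Hk Hc Ht]] Hlr.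
have [Hst Hfr l0 r2N Hb Hs] := Hinv.
(* [k = 0] is excluded by [0 < l < r <= 1]. *)
case: k Hinv Hb Hk Ht => [|k] Hinv Hb Hk Ht; first by rewrite expn0 in Hk; lia.
set l := reg s 12 in l0 Hs Hc Hlr Hinv; set r := reg s 13 in Hs Hc Hlr Hinv Hk r2N.
have E26 : reg s 26 = 1 by rewrite Hfr.1.
have E27 : reg s 27 = 0 by rewrite Hfr.1.
pose l1 := l + odd l.
have okF := step_ok Hst.
have fr4' : 4 * N <= reg s 9 by apply: leq_trans fr4 (step_fresh Hst).
pose Q1 s1 := exists F1, [/\ dec_inv N e lo hi k0 F0 s0 F1 s1 l r 2 k,
  graph_step F s F1 s1, reg s1 12 = l1 /\ reg s1 13 = r,
  forall z, l <= z < l1 -> forall w, w < N -> anc z (N + w) -> linked N s1 h h' w &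
  ticks s1 <= ticks s + 17].
apply: (@wp_seq _ _ _ _ Q1).
  rewrite /= /upd /= ?E26 ?E27 -/l; split=> //; split; first lia.
  (* [2 * l./2 < l] is the program's test for odd [l]. *)
  case: ltnP => Hodd; last first.
    split=> //; exists F; split=> //=; try lia.
    - split=> //.
      + apply: (graph_step_frame (s1 := s) (rs := [:: 16]) (bs := [::])) => //.
        by solve_frame.
      + by apply: frame_trans Hfr _; solve_frame.
      + by move=> /=; rewrite /upd /=; lia.
    - apply: (graph_step_frame (s1 := s) (rs := [:: 16]) (bs := [::])) => //.
        by solve_frame.
      exact: graph_step_refl.
    - rewrite /upd /= -/l -/r /l1; split=> //; lia.
  split; first lia.
  set s1 := set_reg _ 17 _.
  have fr1 : frame [:: 16; 17] [::] s s1 by solve_frame.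
  have st1 : graph_step F s F s1.
    by apply: graph_step_frame fr1 _ _ _ _ => //; apply: graph_step_refl.
  have inv1 : dec_inv N e lo hi k0 F0 s0 F s1 l r 4 k.
    split=> //; first exact: graph_step_trans Hst st1.
      by apply: frame_trans Hfr _; apply: frame_sub fr1.
    by rewrite fr1.1 //; lia.
  have E17 : reg s1 17 = l by rewrite /= /upd /= addn0.
  apply: (wp_emit B Hpre HV inv1); first by rewrite E17; lia.
  move=> s2 F2 inv2 st2 link2 fr2 t2.
  have E12' : reg s2 12 = l by rewrite fr2.1 // fr1.1.
  have E26' : reg s2 26 = 1 by rewrite fr2.1 // fr1.1.
  have l2N : l < 2 * N by lia.
  rewrite /= E12' E26'; split; first by have := dp_fr Hpre; lia.
  have fr3 : frame [:: 12] [::] s2 (set_reg s2 12 (l + 1)) by solve_frame.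
  have st12 := graph_step_trans st1 st2.
  have [st02 fr02 _ _ b2 _] := inv2.
  exists F2; split=> //.
  - split=> //; first exact: graph_step_frame fr3 _ _ _ st02.
    by apply: frame_trans fr02 _; apply: frame_sub fr3.
  - exact: graph_step_frame fr3 _ _ _ st12.
  - rewrite /= /upd /= /l1 fr2.1 // fr1.1 //; split=> //; lia.
  - rewrite E17 in link2 => z Hz w ltw Hw; apply: link2 => //.
    by rewrite (_ : l = z) //; move: Hz; rewrite /l1; lia.
  - by rewrite /= t2 /=; lia.
move=> s1 [F1 [inv1 st1 [E12' E13'] link1 t1]].
pose r1 := r - odd r.
pose Q2 s2 := exists F2, [/\ dec_inv N e lo hi k0 F0 s0 F2 s2 l r 0 k,
  graph_step F1 s1 F2 s2, reg s2 12 = l1 /\ reg s2 13 = r1,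
  forall z, r1 <= z < r -> forall w, w < N -> anc z (N + w) -> linked N s2 h h' w &
  ticks s2 <= ticks s1 + 17].
have [st01 fr01 _ _ b1 _] := inv1.
have ok1 := step_ok st01.
have E26' : reg s1 26 = 1 by rewrite fr01.1.
have E27' : reg s1 27 = 0 by rewrite fr01.1.
apply: (@wp_seq _ _ _ _ Q2).
  rewrite /= /upd /= E13'; split=> //; split; first lia.
  case: ltnP => Hodd; last first.
    split=> //; set s2 := set_reg _ 16 _.
    have fr2 : frame [:: 16] [::] s1 s2 by solve_frame.
    have st2 : graph_step F1 s1 F1 s2.
      by apply: graph_step_frame fr2 _ _ _ _ => //; apply: graph_step_refl.
    exists F1; split=> //=.
    - split=> //; first exact: graph_step_trans st01 st2.
        by apply: frame_trans fr01 _; apply: frame_sub fr2.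
      by rewrite fr2.1 //; lia.
    - rewrite /= /upd /= E12' E13' /r1; split=> //; lia.
    - by move=> z; rewrite /r1; lia.
    - lia.
  rewrite E27' E26'; split=> //; split; first lia.
  set s2 := set_reg _ 17 _.
  have fr2 : frame [:: 13; 16; 17] [::] s1 s2 by solve_frame.
  have st2 : graph_step F1 s1 F1 s2.
    by apply: graph_step_frame fr2 _ _ _ _ => //; apply: graph_step_refl.
  have inv2 : dec_inv N e lo hi k0 F0 s0 F1 s2 l r 2 k.
    split=> //; first exact: graph_step_trans st01 st2.
    by apply: frame_trans fr01 _; apply: frame_sub fr2.
  have E17 : reg s2 17 = r1 by rewrite /= /upd /= addn0 /r1; lia.
  apply: (wp_emit B Hpre HV inv2); first by rewrite E17 /r1; lia.
  move=> s3 F3 inv3 st3 link3 fr3 t3.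
  exists F3; split=> //.
  - exact: graph_step_trans st2 st3.
  - by rewrite !fr3.1 // [reg s2 12]fr2.1 // E12' /= /upd /= /r1; split=> //; lia.
  - rewrite E17 in link3 => z Hz w ltw Hw; apply: link3 => //.
    by rewrite (_ : r1 = z) //; move: Hz; rewrite /r1; lia.
  - by rewrite t3 /=; lia.
move=> s2 [F2 [inv2 st2 [E12'' E13''] link2 t2]].
have [st02 fr02 _ _ b2 _] := inv2.
rewrite /= /upd /= E12'' E13''; split=> //; split=> //.
set s3 := set_reg _ 13 _.
have fr3 : frame [:: 12; 13] [::] s2 s3 by solve_frame.
have st3 : graph_step F2 s2 F2 s3.
  by apply: graph_step_frame fr3 _ _ _ _ => //; apply: graph_step_refl (step_ok st02).
exists k => //; exists F2.
have -> : reg s3 12 = l1./2 by [].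
have -> : reg s3 13 = r1./2 by [].
rewrite expnS in Hk; split.
- split.
  + exact: graph_step_trans st02 st3.
  + by apply: frame_trans fr02 _; apply: frame_sub fr3.
  + by rewrite /l1; lia.
  + by rewrite /r1; lia.
  + by rewrite fr3.1 //; lia.
  + by apply: (@decomp_sound_half N lo hi l r); rewrite ?/l1 ?/r1 //; lia.
- by rewrite /r1; lia.
- move=> w Hw; have ltw : w < N by lia.
  have st23 := graph_step_trans st2 st3; have st13 := graph_step_trans st1 st23.
  apply: (@decomp_complete_half N _ l r); rewrite ?/l1 ?/r1; try lia.
  + by move=> z Hz Az; apply: linked_step st23 _; apply: link1 ltw Az.
  + by move=> z Hz Az; apply: linked_step st3 _; apply: link2 ltw Az.
  + case: (Hc w Hw) => [H|H]; last by right.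
    by left; apply: linked_step st13 _.
- by rewrite /=; lia.
Qed.

Opaque decompose.

(** Passes from a closed interval of vertices to the half-open range of leaves that [decompose]
    expects. *)
Definition load_bounds : cmd :=
  PLoad 0 12 10;; PAdd 12 12 5;; PAdd 10 10 26;;
  PLoad 0 13 10;; PAdd 13 13 5;; PAdd 13 13 26;; PAdd 10 10 26.

(* Registers 28 and 29 hold the fresh hubs of the two sides A and B: every leaf
   of A leads to the hub of A, which leads to every leaf of B, and
   symmetrically. *)
Definition add_biclique : cmd :=
  PAdd 28 9 27;; PAdd 9 9 26;; PAdd 29 9 27;; PAdd 9 9 26;;
  load_bounds;; PAdd 14 28 27;; PAdd 15 29 27;; decompose;;
  load_bounds;; PAdd 14 29 27;; PAdd 15 28 27;; decompose.

Record build_ctx N (e : rel nat) F s : Prop := {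
  bc_one : reg s 26 = 1;
  bc_zero : reg s 27 = 0;
  bc_N : reg s 5 = N;
  bc_2N : reg s 6 = 2 * N;
  bc_ok : graph_ok F (reg s 9) (bank s 1) (bank s 2);
  bc_fr : 4 * N <= reg s 9;
  bc_tree : tree_conn N (bank s 1) (bank s 2);
  bc_label : forall x, x < 4 * N -> F x = tree_label N e x
}.

Lemma build_ctx_step N e F s F' s' rs bs :
  build_ctx N e F s -> graph_step F s F' s' -> frame rs bs s s' ->
  [&& 26 \notin rs, 27 \notin rs, 5 \notin rs & 6 \notin rs] ->
  build_ctx N e F' s'.
Proof.
case=> H26 H27 H5 H6 ok fr tree lab [ok' ext lab' le] [Hr _] /and4P[n26 n27 n5 n6].
split=> //; try by rewrite Hr.
- exact: leq_trans fr le.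
- exact: tree_conn_ext ext tree.
- by move=> x ltx; rewrite lab' ?lab //; lia.
Qed.

Notation biclique_regs := [:: 9; 10; 12; 13; 14; 15; 16; 17; 18; 28; 29].

(** The two calls of [decompose] swap the hubs, so a path from one side to the other enters its hub
    by arcs of one call and leaves it by arcs of the other. The cells are two hubs plus [4 * K] per
    call. *)
Lemma wp_add_biclique V B N e c F s K (Q : state -> Prop) :
  let p := reg s 10 in
  build_ctx N e F s -> 0 < N -> 2 * N <= 2 ^ K ->
  reg s 9 + 8 * K + 4 < V -> p + 4 < V ->
  [/\ bank s 0 p = alo c, bank s 0 (p + 1) = ahi c, bank s 0 (p + 2) = blo c
    & bank s 0 (p + 3) = bhi c] ->
  ahi c < N -> bhi c < N -> alo c < N -> blo c < N ->
  (forall u w, inI (alo c) (ahi c) u -> inI (blo c) (bhi c) w -> e u w /\ e w u) ->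
  (forall F' s', graph_step F s F' s' -> frame biclique_regs [:: 1; 2] s s' ->
     reg s' 10 = p + 4 ->
     (forall u w, covers c u w ->
        gconn (bank s' 1) (bank s' 2) (N + u) (3 * N + w)) ->
     reg s' 9 <= reg s 9 + 2 + 8 * K -> ticks s' <= ticks s + 80 * K + 40 ->
     Q s') ->
  wp V B add_biclique Q s.
Proof.
move=> p Hctx N0 leK HV HVp [Ea1 Ea2 Eb1 Eb2] lta ltb lta' ltb' He HQ.
have [E26 E27 E5 E6 ok fr4 tree lab] := Hctx.
set hA := reg s 9 in ok fr4 HV HQ.
(* Each hub is labelled by its own side: all of that side enters it, and each member is adjacent to
   the whole other side. *)
pose F2 x := if x == hA.+1 then inI (blo c) (bhi c) : nat -> Prop else
  if x == hA then inI (alo c) (ahi c) : nat -> Prop else F x.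
have ok2 : graph_ok F2 hA.+2 (bank s 1) (bank s 2).
  by apply: graph_ok_alloc; apply: graph_ok_alloc.
rewrite addn1 in Ea2; rewrite addn2 in Eb1; rewrite addn3 in Eb2.
rewrite /add_biclique /load_bounds.
do 13 wp_step ltac:(rewrite ?E26 ?E27 ?E5 -?/hA -?/p ?addn0 ?addn1 ?Ea1 ?Ea2).
set s1 := set_reg _ 15 _.
have fr1 : frame biclique_regs [::] s s1 by solve_frame.
have st1 : graph_step F s F2 s1.
  split=> //=; last by rewrite /upd /= -/hA; lia.
  by move=> x; rewrite -/hA => ltx; rewrite /F2 !ifN //; lia.
have ctx1 : build_ctx N e F2 s1 by apply: build_ctx_step Hctx st1 fr1 _.
have pre1 : dec_pre N e (alo c) (ahi c) F2 s1.
  have [? ? ? ? ? ? ? ?] := ctx1; split=> //=; rewrite /upd /=; try lia.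
  - by move=> u Hu; rewrite /F2 ifN ?eqxx //; lia.
  - move=> u w; rewrite /F2 eqxx => Hu Hw.
    by have [] := He w u Hw Hu.
have E9 : reg s1 9 = hA.+2 by [].
rewrite wp_seqE; apply: (wp_decompose B pre1 (k0 := K)) => //; try by rewrite /= /upd /=; lia.
move=> s2 F3 st2 fr2 link2 le2 t2.
have E10 : reg s2 10 = p.+2 by rewrite fr2.1.
have E28 : reg s2 28 = hA by rewrite fr2.1.
have E29 : reg s2 29 = hA.+1 by rewrite fr2.1.
have ctx2 : build_ctx N e F3 s2 by apply: build_ctx_step ctx1 st2 fr2 _.
have [E26' E27' E5' E6' ok3 fr4' tree' lab'] := ctx2.
have E0 : bank s2 0 = bank s 0 by rewrite fr2.2.
do 9 wp_step ltac:(rewrite ?E26' ?E27' ?E5' ?E10 ?E28 ?E29 ?E0 ?addn0 ?addn1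
  ?Eb1 ?Eb2).
set s3 := set_reg _ 15 _.
have fr3 : frame biclique_regs [::] s2 s3 by solve_frame.
have st3 : graph_step F3 s2 F3 s3.
  have fr3' : frame [:: 10; 12; 13; 14; 15] [::] s2 s3 by solve_frame.
  by apply: graph_step_frame fr3' _ _ _ _ => //; apply: graph_step_refl.
have ctx3 : build_ctx N e F3 s3 by apply: build_ctx_step ctx2 st3 fr3 _.
have pre3 : dec_pre N e (blo c) (bhi c) F3 s3.
  have [? ? ? ? ? ? ? ?] := ctx3.
  have le := step_fresh st2; rewrite E9 in le.
  split=> //=; rewrite /upd /=; try lia.
  - move=> u Hu; rewrite (step_label st2) ?E9 //.
    by rewrite /F2 eqxx.
  - move=> u w; rewrite (step_label st2) ?E9 // /F2 ifN ?eqxx; last lia.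
    by move=> Hu Hw; have [] := He u w Hu Hw.
apply: (wp_decompose B pre3 (k0 := K)) => //=; rewrite /upd /=; try lia.
move=> s4 F4 st4 fr4'' link4 le4 t4.
have st := graph_step_trans (graph_step_trans st1 st2) (graph_step_trans st3 st4).
apply: (HQ _ _ st).
- apply: frame_trans (frame_sub _ _ fr1) _ => //.
  apply: frame_trans (frame_sub _ _ fr2) _ => //.
  by apply: frame_trans (frame_sub _ _ fr3) (frame_sub _ _ fr4'').
- by rewrite fr4''.1 //= /upd /=; lia.
- move=> u w /orP[]/andP[Hu Hw].
  + have [H1 _] := linked_step (graph_step_trans st3 st4) (link2 u Hu).
    have [_ H2] := link4 w Hw.
    exact: gconn_trans H1 H2.
  + have [_ H1] := linked_step (graph_step_trans st3 st4) (link2 w Hu).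
    have [H2 _] := link4 u Hw.
    exact: gconn_trans H2 H1.
- lia.
- by move: t2 t4 => /=; lia.
Qed.

Opaque add_biclique.

(** * Initialisation, segment trees, and the loop over the bicliques *)

Definition init_regs : cmd :=
  PConst 27 0;; PConst 26 1;; PAdd 5 0 26;; PAdd 6 5 5;; PAdd 7 6 5;;
  PAdd 8 6 6;; PAdd 9 8 27;; PAdd 11 2 2;; PAdd 11 11 11;;
  PConst 16 46;; PAdd 3 11 16;; PAdd 4 3 5.

(** Starts at 36 because input cells 5 to 40 are moved to positions 0 to 35 of bank 0 before this
    program runs. *)
Definition copy_input : cmd :=
  PConst 10 36;;
  CWhile 10 11 (PConst 16 5;; PAdd 16 16 10;; PRawLoad 17 16;; PStore 0 10 17;;
                PAdd 10 10 26).

(** Stops at [3N]: the second leaves [[3N, 4N)] are sinks, hence already correct in zeroed banks. *)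
Definition build_trees : cmd :=
  PAdd 10 27 27;;
  CWhile 10 7 (
    CIf 10 6
      (PHalf 16 10;; PStore 1 10 16)
      (PSub 16 10 6;; PAdd 16 16 10;; PStore 1 10 16;; PAdd 16 16 26;;
       PStore 2 10 16);;
    PAdd 10 10 26).

Definition add_bicliques : cmd := PAdd 10 27 27;; CWhile 10 11 add_biclique.

Lemma wp_copy_input V B s m (Q : state -> Prop) :
  reg s 26 = 1 -> reg s 11 = 4 * m -> 4 * m + 5 <= B -> 4 * m + 40 < V ->
  (forall s', frame [:: 10; 16; 17] [:: 0] s s' ->
     (forall x, x < 36 -> bank s' 0 x = bank s 0 x) ->
     (forall x, 36 <= x < 4 * m -> bank s' 0 x = bank s 8 (5 + x)) ->
     ticks s' <= ticks s + 24 * m + 2 -> Q s') ->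
  wp V B copy_input Q s.
Proof.
move=> E26 E11 ltB ltV HQ; split; first by move=> /=; lia.
set s1 := prim_eff _ s.
pose I k s' := [/\ frame [:: 10; 16; 17] [:: 0] s s',
  36 <= reg s' 10 /\ k = 4 * m - reg s' 10,
  forall x, x < 36 -> bank s' 0 x = bank s 0 x,
  forall x, 36 <= x < reg s' 10 -> bank s' 0 x = bank s 8 (5 + x) &
  ticks s' + 6 * k <= ticks s + 24 * m + 1].
apply: (@wp_while _ _ _ _ _ _ I (4 * m - 36)); last first.
- split=> //=; first by solve_frame.
  + by move=> x; rewrite /upd /=; lia.
  + by lia.
- move=> k s' [Hfr [le36 Ek] H1 H2 Ht]; rewrite (Hfr.1 11) // E11 => Hj.
  apply: HQ => //=; last by lia.
  by move=> x Hx; apply: H2; lia.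
move=> k s' [Hfr [le36 Ek] H1 H2 Ht]; rewrite (Hfr.1 11) // E11 => Hj.
set j := reg s' 10 in le36 Ek H2 Hj.
rewrite /= /upd /= (Hfr.1 26) // E26 -/j (Hfr.2 8) //.
do ![split; first by lia].
exists (4 * m - (j + 1)); first lia.
split=> //=.
- by apply: frame_trans Hfr _; solve_frame.
- by rewrite /upd /=; lia.
- by move=> x ltx; rewrite /upd /= ifN ?H1 //; lia.
- move=> x; rewrite /upd /= => Hx; case: eqP => [->//|?].
  by rewrite H2 //; lia.
- lia.
Qed.

Lemma wp_build_trees V B s N (Q : state -> Prop) :
  reg s 26 = 1 -> reg s 27 = 0 -> reg s 6 = 2 * N -> reg s 7 = 3 * N ->
  4 * N < V -> (forall x, bank s 1 x = 0) -> (forall x, bank s 2 x = 0) ->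
  (forall s', frame [:: 10; 16] [:: 1; 2] s s' ->
     bank s' 1 =1 tree_left N -> bank s' 2 =1 tree_right N ->
     ticks s' <= ticks s + 24 * N + 2 -> Q s') ->
  wp V B build_trees Q s.
Proof.
move=> E26 E27 E6 E7 ltV L0 R0 HQ; split; first by rewrite /= E27; lia.
set s1 := prim_eff _ s.
pose I k s' := [/\ frame [:: 10; 16] [:: 1; 2] s s',
  reg s' 10 + k = 3 * N,
  forall x, bank s' 1 x = if x < reg s' 10 then tree_left N x else 0,
  forall x, bank s' 2 x = if x < reg s' 10 then tree_right N x else 0 &
  ticks s' + 8 * k <= ticks s + 24 * N + 1].
apply: (@wp_while _ _ _ _ _ _ I (3 * N)); last first.
- have E10 : reg s1 10 = 0 by rewrite /= /upd /= E27.
  split; first by solve_frame.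
  + by rewrite E10.
  + by move=> x; rewrite E10 /= L0.
  + by move=> x; rewrite E10 /= R0.
  + by rewrite /=; lia.
- move=> k s' [Hfr Ek HL HR Ht]; rewrite (Hfr.1 7) // E7 => Hj.
  apply: HQ => //=; last by lia.
  + move=> x; rewrite HL; case: ifP => // Hx.
    by rewrite /tree_left !ifN //; lia.
  + move=> x; rewrite HR; case: ifP => // Hx.
    by rewrite /tree_right ifN //; lia.
move=> k s' [Hfr Ek HL HR Ht]; rewrite (Hfr.1 7) // E7 => Hj.
have E26' : reg s' 26 = 1 by rewrite Hfr.1.
have E6' : reg s' 6 = 2 * N by rewrite Hfr.1.
rewrite /= E6'; set y := reg s' 10 in Ek HL HR Hj *.
case: ltnP => Hy; rewrite /= /upd /= -/y E26' ?E6'.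
  do ![split; first by lia].
  exists k.-1; first lia.
  split=> /=.
  - by apply: frame_trans Hfr _; solve_frame.
  - by rewrite /upd /=; lia.
  - move=> x; rewrite /upd /= HL; case: eqP => [->|ne].
      by rewrite ifT /tree_left ?Hy //; lia.
    by rewrite (_ : (x < y + 1) = (x < y)) //; lia.
  - move=> x; rewrite /upd /= HR; case: (x =P y) => [->|ne].
      by rewrite ltnn ifT /tree_right ?ifN //; lia.
    by rewrite (_ : (x < y + 1) = (x < y)) //; lia.
  - lia.
do ![split; first by lia].
exists k.-1; first lia.
split=> /=.
- by apply: frame_trans Hfr _; solve_frame.
- by rewrite /upd /=; lia.
- move=> x; rewrite /upd /= HL; case: eqP => [->|ne].
    rewrite ifT; last lia.
    by rewrite /tree_left ifN; [rewrite ifT|]; lia.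
  by rewrite (_ : (x < y + 1) = (x < y)) //; lia.
- move=> x; rewrite /upd /= HR; case: (x =P y) => [->|ne].
    by rewrite ifT /tree_right ?ifT //; lia.
  by rewrite (_ : (x < y + 1) = (x < y)) //; lia.
- lia.
Qed.

Lemma wp_add_bicliques V B n e bs F s K (Q : state -> Prop) :
  let N := n.+1 in let m := size bs in
  (forall a b, e a b = e b a) -> interval_biclique_partition n e bs ->
  build_ctx N e F s -> 2 * N <= 2 ^ K -> reg s 11 = 4 * m ->
  reg s 9 + m.+1 * (8 * K + 2) + 4 < V -> 4 * m + 4 < V ->
  (forall i, i < m -> let c := nth (IBic 0 0 0 0) bs i in
    [/\ bank s 0 (4 * i) = alo c, bank s 0 (4 * i + 1) = ahi c,
        bank s 0 (4 * i + 2) = blo c & bank s 0 (4 * i + 3) = bhi c]) ->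
  (forall F' s', build_ctx N e F' s' -> frame biclique_regs [:: 1; 2] s s' ->
     (forall u w, e u w -> gconn (bank s' 1) (bank s' 2) (N + u) (3 * N + w)) ->
     reg s' 9 <= reg s 9 + m * (8 * K + 2) ->
     ticks s' <= ticks s + m * (80 * K + 41) + 2 -> Q s') ->
  wp V B add_bicliques Q s.
Proof.
move=> N m sym [Hwf [Hin Hcov]] Hctx leK E11 HV HVm Hbank HQ.
have nthIn i : i < m -> List.In (nth (IBic 0 0 0 0) bs i) bs.
  rewrite /m; elim: bs i {Hwf Hin Hcov Hbank HQ HV HVm E11 m} => // c bs IH [|i] /=.
    by left.
  by move=> lti; right; apply: IH.
split; first by rewrite /= (bc_zero Hctx); lia.
set s1 := prim_eff _ s.
pose I k s' := exists F', [/\ graph_step F s F' s', frame biclique_regs [:: 1; 2] s s' &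
  exists2 i, reg s' 10 = 4 * i /\ i + k = m &
   [/\ forall j u w, j < i -> covers (nth (IBic 0 0 0 0) bs j) u w ->
       gconn (bank s' 1) (bank s' 2) (N + u) (3 * N + w),
     reg s' 9 <= reg s 9 + i * (8 * K + 2) &
     ticks s' <= ticks s + i * (80 * K + 41) + 1]].
apply: (@wp_while _ _ _ _ _ _ I m); last first.
- exists F; split; last first.
  + exists 0; first by rewrite /= /upd /= (bc_zero Hctx); split; lia.
    by split=> //=; rewrite ?/upd /=; lia.
  + by solve_frame.
  + by case: Hctx => _ _ _ _ ok _ _ _; split.
- move=> k s' [F' [st Hfr [i [E10 Ek] [Hc Hle Ht]]]]; rewrite E10 (Hfr.1 11) // E11 => Hi.
  have Ei : i = m by lia.
  rewrite Ei in Hc Hle Ht.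
  have st' : graph_step F s F' (tick s') by case: st; split.
  apply: (HQ F') => //=; last by lia.
    by apply: build_ctx_step Hctx st' Hfr _.
  move=> u w /Hcov Hcount.
  have : has (fun c => covers c u w) bs by rewrite has_count Hcount.
  case/(has_nthP (IBic 0 0 0 0)) => j ltj; exact: Hc.
move=> k s' [F' [st Hfr [i [E10 Ek] [Hc Hle Ht]]]]; rewrite E10 (Hfr.1 11) // E11 => Hi.
have lti : i < m by lia.
set c := nth (IBic 0 0 0 0) bs i.
have [/and5P[a1 a2 a3 b1 /andP[b2 b3]] _] := Hwf c (nthIn i lti).
have Hmul : i.+1 * (8 * K + 2) <= m * (8 * K + 2) by rewrite leq_mul2r lti orbT.
have HVi : reg s' 9 + 8 * K + 4 < V by lia.
have st' : graph_step F s F' (tick s') by case: st; split.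
have ctx : build_ctx N e F' (tick s') by apply: build_ctx_step Hctx st' Hfr _.
have [B0 B1 B2 B3] := Hbank i lti.
apply: (wp_add_biclique (c := c) B ctx _ leK HVi); rewrite /= ?E10 /N //; try lia.
- by rewrite Hfr.2.
- move=> u w Hu Hw; have Huw := Hin c u w (nthIn i lti) Hu Hw.
  by split=> //; rewrite sym.
move=> F2 s2 st2 fr2 E10' Hc2 Hle2 Ht2.
exists k.-1; first lia.
exists F2; split.
- exact: graph_step_trans st' st2.
- exact: frame_trans Hfr fr2.
exists i.+1; first by split; lia.
split.
- move=> j u w; rewrite ltnS leq_eqVlt => /orP[/eqP->|ltj Hcj]; first exact: Hc2.
  exact: gconn_ext (step_ext st2) (Hc j u w ltj Hcj).
- by rewrite mulSn; lia.
- by rewrite mulSn; lia.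
Qed.

(** * Breadth-first search *)

(* The first j entries of the queue q[0..qt) have been processed; d is the
   distance plus one, 0 on unvisited vertices. *)
Record bfs_inv (n : nat) (e : rel nat) (src qt j : nat)
    (q : nat -> nat) (vis : nat -> bool) (d par : nat -> nat) : Prop := {
  bfs_queue : forall i, i < qt -> 1 <= q i <= n /\ vis (q i);
  bfs_vis : forall v, 1 <= v <= n -> vis v -> exists2 i, i < qt & q i = v;
  bfs_d : forall v, 1 <= v <= n -> (0 < d v) = vis v;
  bfs_mono : forall i k, i <= k < qt -> d (q i) <= d (q k);
  bfs_bound : forall i, i < qt -> d (q i) <= i.+1;
  bfs_path : forall v, 1 <= v <= n -> vis v ->
    exists p, [/\ path e src p, last src p = v & (size p).+1 = d v];
  bfs_parent : forall v, 1 <= v <= n -> vis v -> v != src ->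
    [/\ e (par v) v, 1 <= par v <= n, vis (par v) & (d (par v)).+1 = d v];
  bfs_done : forall i, i < j -> forall w, e (q i) w ->
    vis w /\ d w <= (d (q i)).+1;
  bfs_src : vis src /\ d src = 1;
  bfs_jqt : j <= qt
}.

(** The distance and parent arrays are adjacent windows of the raw bank, where a write acts as an
    update of one array only for indices in [1..n]; the invariant must therefore depend on these
    indices alone. *)
Lemma bfs_inv_ext n (e : rel nat) src qt j q q' vis vis' d d' par par' :
  (forall a b, e a b -> (1 <= a <= n) && (1 <= b <= n)) -> 1 <= src <= n ->
  (forall i, i < qt -> q' i = q i) ->
  (forall v, 1 <= v <= n ->
     [/\ vis' v = vis v, d' v = d v & par' v = par v]) ->
  bfs_inv n e src qt j q vis d par -> bfs_inv n e src qt j q' vis' d' par'.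
Proof.
move=> He Hsrc Eq E [H1 H2 H3 H4 H5 H6 H7 H8 [H9 H9'] H10].
have Evis v : 1 <= v <= n -> vis' v = vis v by case/E.
have Ed v : 1 <= v <= n -> d' v = d v by case/E.
have Epar v : 1 <= v <= n -> par' v = par v by case/E.
have rq i : i < qt -> 1 <= q i <= n by case/H1.
split=> //.
- by move=> i lti; rewrite Eq // Evis ?rq //; case: (H1 i lti).
- move=> v Hv; rewrite Evis // => /(H2 v Hv)[i lti Ei]; exists i => //.
  by rewrite Eq.
- by move=> v Hv; rewrite Evis // Ed // H3.
- move=> i k Hik; have lti : i < qt by lia.
  have ltk : k < qt by lia.
  by rewrite !Eq // !Ed ?rq //; apply: H4.
- by move=> i lti; rewrite Eq // Ed ?rq //; apply: H5.
- by move=> v Hv; rewrite Evis // Ed //; apply: H6.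
- move=> v Hv; rewrite Evis // Epar // (Ed v) // => Vv nv.
  have [h1 h2 h3 h4] := H7 v Hv Vv nv.
  by rewrite Evis // Ed.
- move=> i lti w; have ltq : i < qt by lia.
  rewrite Eq // => Hw; have /andP[rqi rw] := He _ _ Hw.
  by rewrite Evis // !Ed //; apply: H8.
- by rewrite Evis // Ed.
Qed.

(** The bound [d u <= (d v).+1] on visited vertices keeps distances nondecreasing along the queue
    when [w] is appended. *)
Lemma bfs_inv_visit n (e : rel nat) src qt j q vis d par v w :
  (forall a b, e a b -> (1 <= a <= n) && (1 <= b <= n)) ->
  bfs_inv n e src qt j q vis d par ->
  vis v -> e v w -> ~~ vis w ->
  (forall u, 1 <= u <= n -> vis u -> d u <= (d v).+1) ->
  bfs_inv n e src qt.+1 j (upd q qt w) (fun x => (x == w) || vis x)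
    (upd d w (d v).+1) (upd par w v).
Proof.
move=> He [H1 H2 H3 H4 H5 H6 H7 H8 [H9 H9'] H10] Vv Hvw nVw Hle.
have /andP[rv rw] := He _ _ Hvw.
have neq_vis u : vis u -> (u == w) = false.
  by move=> Vu; apply: contraNF nVw => /eqP <-.
have Eq i : i < qt -> upd q qt w i = q i by rewrite /upd ltn_neqAle => /andP[/negbTE->].
have Eqt : upd q qt w qt = w by rewrite /upd eqxx.
have Ed u : vis u -> upd d w (d v).+1 u = d u by rewrite /upd => /neq_vis->.
have Ew : upd d w (d v).+1 w = (d v).+1 by rewrite /upd eqxx.
have Vq i : i < qt -> vis (q i) by case/H1.
have ltS i : i < qt.+1 -> i < qt \/ i = qt by lia.
split.
- move=> i /ltS[lti|->]; last by rewrite Eqt eqxx.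
  by rewrite Eq // Vq // orbT; case: (H1 i lti).
- move=> u ru /orP[/eqP->|/(H2 u ru)[i lti Ei]]; first by exists qt.
  by exists i; [lia|rewrite Eq].
- move=> u ru; rewrite /upd; case: eqP => //= _; exact: H3.
- move=> i k /andP[leik /ltS[ltk|Ek]].
    have lti : i < qt by lia.
    by rewrite !Eq // !Ed ?Vq //; apply: H4; lia.
  rewrite Ek Eqt Ew; rewrite Ek leq_eqVlt in leik.
  case/predU1P: leik => [->|lti]; first by rewrite Eqt Ew.
  rewrite Eq // Ed ?Vq //; apply: Hle; last exact: Vq.
  by case: (H1 i lti).
- move=> i /ltS[lti|->]; first by rewrite Eq // Ed ?Vq //; apply: H5.
  rewrite Eqt Ew; have [k ltk <-] := H2 v rv Vv.
  by have := H5 k ltk; lia.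
- move=> u ru /orP[/eqP->|Vu]; last by rewrite Ed //; apply: H6.
  have [p [Hp Lp Sp]] := H6 v rv Vv.
  exists (rcons p w); rewrite rcons_path Hp Lp Hvw last_rcons size_rcons Ew.
  by rewrite Sp.
- move=> u ru /orP[/eqP->|Vu] nu.
    have -> : upd par w v w = v by rewrite /upd eqxx.
    by rewrite Ew Vv orbT Ed.
  have [h1 h2 h3 h4] := H7 u ru Vu nu.
  have -> : upd par w v u = par u by rewrite /upd neq_vis.
  by rewrite h3 orbT !Ed.
- move=> i lti u; have ltq : i < qt by lia.
  rewrite Eq // => /(H8 i lti)[Vu du].
  by rewrite Vu orbT !Ed ?Vq.
- by rewrite H9 orbT Ed.
- lia.
Qed.

(** With every queue entry processed, visited vertices are closed under edges and [d] rises by at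
    most one per edge, which bounds path lengths from below; [bfs_path] provides a path attaining
    the bound. *)
Lemma bfs_inv_output n (e : rel nat) src qt q vis d par :
  (forall a b, e a b -> (1 <= a <= n) && (1 <= b <= n)) -> 1 <= src <= n ->
  bfs_inv n e src qt qt q vis d par ->
  forall v, 1 <= v <= n ->
    (reachable e src v ->
       is_dist e src v (d v).-1 /\ 0 < d v /\
       (v != src -> e (par v) v /\ is_dist e src (par v) (d v).-2)) /\
    (~ reachable e src v -> d v = 0).
Proof.
move=> He Hsrc [H1 H2 H3 H4 H5 H6 H7 H8 [H9 H9'] H10] v Hv.
have Hpath p u : 1 <= u <= n -> vis u -> path e u p ->
    [/\ 1 <= last u p <= n, vis (last u p) & d (last u p) <= d u + size p].
  elim: p u => [|x p IH] u ru Vu /=; first by rewrite addn0.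
  case/andP=> Hux Hp; have /andP[_ rx] := He _ _ Hux.
  have [i lti Ei] := H2 u ru Vu; rewrite -Ei in Hux.
  have [Vx dx] := H8 i lti x Hux.
  have [h1 h2 h3] := IH x rx Vx Hp; split=> //.
  by rewrite Ei in dx; lia.
have Hdist u : 1 <= u <= n -> vis u -> is_dist e src u (d u).-1.
  move=> ru Vu; split; first by have [p [h1 h2 h3]] := H6 u ru Vu; exists p; rewrite -h3.
  move=> p Hp Lp; have [_ _] := Hpath p src Hsrc H9 Hp.
  by rewrite Lp H9'; lia.
split=> [[p [Hp Lp]]|nR].
  have [_ Vv _] := Hpath p src Hsrc H9 Hp; rewrite Lp in Vv.
  split; first exact: Hdist.
  split; first by rewrite H3.
  move=> nv; have [h1 h2 h3 h4] := H7 v Hv Vv nv; split=> //.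
  by rewrite -h4; apply: Hdist.
apply/eqP; rewrite eqn0Ngt H3 //; apply/negP => Vv; apply: nR.
by have [p [h1 h2 _]] := H6 v Hv Vv; exists p.
Qed.

Lemma bfs_inv_init n (e : rel nat) src q d par :
  1 <= src <= n -> q 0 = src -> d src = 1 ->
  (forall v, 1 <= v <= n -> v != src -> d v = 0) ->
  bfs_inv n e src 1 0 q (eq_op^~ src) d par.
Proof.
move=> Hsrc q0 dsrc d0; split=> //.
- by case=> // _; rewrite q0 eqxx.
- by move=> v Hv /eqP->; exists 0.
- by move=> v Hv; case: eqP => [->|/eqP nv]; rewrite ?dsrc ?d0.
- by case=> [|i] [|k] //; lia.
- by case=> // _; rewrite q0 dsrc.
- by move=> v Hv /eqP->; exists [::]; rewrite dsrc.
- by move=> v Hv /eqP->; rewrite eqxx.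
Qed.

(** * The search program and its amortized cost, with the unmarked nodes as potential *)

Fixpoint zeros (M : nat -> nat) (k : nat) : nat :=
  if k is k'.+1 then zeros M k' + (M k' == 0) else 0.

Lemma zeros_leq M k : zeros M k <= k.
Proof. by elim: k => //= k IH; case: eqP => _; lia. Qed.

Lemma zeros_upd M k y : y < k -> M y = 0 -> (zeros (upd M y 1) k).+1 = zeros M k.
Proof.
have Hge j : j <= y -> zeros (upd M y 1) j = zeros M j.
  elim: j => //= j IH ltj; rewrite IH; last lia.
  by rewrite /upd ifN //; lia.
elim: k => //= k IH; rewrite ltnS leq_eqVlt => /predU1P[<-|ltk] My.
  by rewrite Hge // /upd eqxx My; lia.
by rewrite -IH // {2}/upd ifN //; lia.
Qed.

(* Node in register 17, current vertex in 23, its distance plus two in 24,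
   bounds of the pending queue in 20 and 21, stack height in 22. *)
Definition visit : cmd :=
  PStore 3 17 26;;
  CIf 17 7 nop (CIf 17 8
    (PSub 19 17 7;; PAdd 16 3 19;; PRawLoad 18 16;;
     CIf 18 26
       (PRawStore 16 24;; PAdd 16 4 19;; PRawStore 16 23;; PStore 4 21 19;;
        PAdd 21 21 26)
       nop)
    nop).

(** Absent successors are pushed too: node 0 is marked from the outset, so popping it has no
    effect. *)
Definition push_successors : cmd :=
  PLoad 1 16 17;; PStore 5 22 16;; PAdd 22 22 26;;
  PLoad 2 16 17;; PStore 5 22 16;; PAdd 22 22 26.

Definition explore : cmd :=
  CWhile 27 22 (
    PSub 22 22 26;; PLoad 5 17 22;; PLoad 3 18 17;;
    CIf 18 26 (visit;; push_successors) nop).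

Definition search : cmd :=
  PStore 3 27 26;; PStore 4 27 1;; PAdd 20 27 27;; PAdd 21 26 27;;
  PAdd 16 3 1;; PRawStore 16 26;;
  CWhile 20 21 (
    PLoad 4 23 20;; PAdd 20 20 26;; PAdd 16 3 23;; PRawLoad 24 16;;
    PAdd 24 24 26;; PAdd 16 5 23;; PStore 5 27 16;; PAdd 22 26 27;;
    explore).

Record search_ctx V B n (e : rel nat) src F s0 : Prop := {
  sc_N : reg s0 5 = n.+1;
  sc_3N : reg s0 7 = 3 * n.+1;
  sc_4N : reg s0 8 = 4 * n.+1;
  sc_one : reg s0 26 = 1;
  sc_zero : reg s0 27 = 0;
  sc_par : reg s0 4 = reg s0 3 + n.+1;
  sc_raw : 41 <= reg s0 3 /\ reg s0 3 + 2 * n.+1 <= B;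
  sc_ok : graph_ok F (reg s0 9) (bank s0 1) (bank s0 2);
  sc_fr : 4 * n.+1 <= reg s0 9;
  sc_label : forall x, x < 4 * n.+1 -> F x = tree_label n.+1 e x;
  sc_conn : forall u w, e u w ->
    gconn (bank s0 1) (bank s0 2) (n.+1 + u) (3 * n.+1 + w);
  sc_V : 4 * reg s0 9 + reg s0 3 + 2 * n.+1 + 20 < V;
  sc_e : forall a b, e a b -> (1 <= a <= n) && (1 <= b <= n);
  sc_src : 1 <= src <= n
}.

Notation search_regs := [:: 16; 17; 18; 19; 20; 21; 22; 23; 24].
Notation search_banks := [:: 3; 4; 5; 8].

Definition dist_of s0 s v := bank s 8 (reg s0 3 + v).
Definition par_of n s0 s v := bank s 8 (reg s0 3 + n.+1 + v).
Definition visited s0 s v := 0 < dist_of s0 s v.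

Notation search_inv n e src s0 j s :=
  (bfs_inv n e src (reg s 21) j (bank s 4) (visited s0 s) (dist_of s0 s)
     (par_of n s0 s)).

(* Exploration from v, the queue entry j: the successors of marked nodes are
   marked or pending ([X]). Each unmarked node is worth 120 credits, of which it
   pays 60 if it adds a queue entry, and [a] credits are reserved. *)
Record dfs_inv n (e : rel nat) src s0 j v dv T (X : nat -> Prop) a s : Prop := {
  dfs_frame : frame search_regs search_banks s0 s;
  dfs_regs : [/\ reg s 20 = j.+1, reg s 23 = v & reg s 24 = dv.+1];
  dfs_bfs : search_inv n e src s0 j s;
  dfs_cur : [/\ 1 <= v <= n, j < reg s 21, bank s 4 j = v & dist_of s0 s v = dv];
  dfs_max : forall u, 1 <= u <= n -> visited s0 s u -> dist_of s0 s u <= dv.+1;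
  dfs_leaf : forall u, 1 <= u <= n -> 0 < bank s 3 (3 * n.+1 + u) -> visited s0 s u;
  dfs_closed : forall x y, x <> 0 -> 0 < bank s 3 x -> y <> 0 ->
    y = bank s0 1 x \/ y = bank s0 2 x -> 0 < bank s 3 y \/ X y;
  dfs_root : 0 < bank s 3 (n.+1 + v) \/ X (n.+1 + v);
  dfs_null : 0 < bank s 3 0;
  dfs_qt : reg s 21 + zeros (bank s 3) (reg s0 9) <= (reg s0 9).+1;
  dfs_ticks : ticks s + 30 * (4 * zeros (bank s 3) (reg s0 9) + 2 * reg s 21) + a <= T
}.

Lemma dfs_inv_frame n e src s0 j v dv T X a s (X' : nat -> Prop) a' s' :
  frame [:: 16; 17; 18; 19; 22] [:: 5] s s' ->
  (forall x, X x -> 0 < bank s 3 x \/ X' x) -> ticks s' + a' <= ticks s + a ->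
  dfs_inv n e src s0 j v dv T X a s -> dfs_inv n e src s0 j v dv T X' a' s'.
Proof.
move=> Hfr HX Ht [fr regs bfs cur mx lf cl root null qt tk].
have E3 : bank s' 3 = bank s 3 by apply Hfr.
have E4 : bank s' 4 = bank s 4 by apply Hfr.
have E8 : bank s' 8 = bank s 8 by apply Hfr.
have E21 : reg s' 21 = reg s 21 by apply Hfr.
split; rewrite /visited /dist_of /par_of ?E3 ?E4 ?E8 ?E21 //.
- by apply: frame_trans fr _; apply: frame_sub Hfr.
- by rewrite !Hfr.1.
- by move=> x y x0 Hx y0 Hy; case: (cl x y x0 Hx y0 Hy) => [|/HX]; [left|].
- by case: root => [|/HX]; [left|].
- lia.
Qed.

(** Marking [y] frees 120 credits; a queue entry takes 60 and the code at most 12 ticks, leaving 48.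
    The successors of [y] count as pending in [X'] although they are pushed only afterwards. *)
Lemma wp_visit V B n e src F s0 j v dv T X X' a s (Q : state -> Prop) :
  let y := reg s 17 in
  search_ctx V B n e src F s0 -> dfs_inv n e src s0 j v dv T X a s ->
  bank s 3 y = 0 -> y < reg s0 9 -> F y v ->
  (forall x, X x -> x = y \/ X' x) ->
  X' (bank s0 1 y) -> X' (bank s0 2 y) ->
  (forall s', dfs_inv n e src s0 j v dv T X' (a + 48) s' ->
     (zeros (bank s' 3) (reg s0 9)).+1 = zeros (bank s 3) (reg s0 9) ->
     reg s' 17 = y -> reg s' 22 = reg s 22 -> bank s' 5 = bank s 5 -> Q s') ->
  wp V B visit Q s.
Proof.
move=> y ctx inv My lty Fy HX XL XR HQ.
have [EN E3N E4N E1 E0 Epar [raw1 raw2] ok frN lab conn ltV He Hsrc] := ctx.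
have [fr [R20 R23 R24] bfs [rv jqt Qj Dv] mx lf cl root null qt tk] := inv.
have E26 : reg s 26 = 1 by rewrite fr.1.
have E7 : reg s 7 = 3 * n.+1 by rewrite fr.1.
have E8 : reg s 8 = 4 * n.+1 by rewrite fr.1.
have E3 : reg s 3 = reg s0 3 by rewrite fr.1.
have E4 : reg s 4 = reg s0 3 + n.+1 by rewrite fr.1.
have Hz := zeros_upd lty My.
set M' := upd (bank s 3) y 1 in Hz.
have markS x : 0 < bank s 3 x -> 0 < M' x by rewrite /M' /upd; case: eqP.
have mark_y : 0 < M' y by rewrite /M' /upd eqxx.
have markI x : 0 < M' x -> x = y \/ 0 < bank s 3 x.
  by rewrite /M' /upd; case: eqP => [->|]; [left|right].
have XM x : X x -> 0 < M' x \/ X' x by case/HX => [->|]; [left|right].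
have cl' x z : x <> 0 -> 0 < M' x -> z <> 0 -> z = bank s0 1 x \/ z = bank s0 2 x ->
    0 < M' z \/ X' z.
  move=> x0; case/markI => [-> _ [->|->]|Hx z0 Hz']; [by right|by right|].
  by case: (cl x z x0 Hx z0 Hz') => [/markS|/XM]; [left|].
have root' : 0 < M' (n.+1 + v) \/ X' (n.+1 + v).
  by case: root => [/markS|/XM]; [left|].
have vv : visited s0 s v by rewrite -Qj; case: (bfs_queue bfs jqt).
(* Common end of the branches that discover no vertex: [y] lies below the second leaves, is a hub or
   list cell, or is a second leaf already visited. *)
have other t : (3 * n.+1 <= y < 4 * n.+1 -> visited s0 s (y - 3 * n.+1)) ->
    t <= 8 -> forall s1, frame [:: 16; 18; 19] [:: 3] s s1 -> bank s1 3 = M' ->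
    ticks s1 = ticks s + t -> Q s1.
  move=> ny let8 s1 fr1 EM Et.
  have E8' : bank s1 8 = bank s 8 by rewrite fr1.2.
  apply: HQ; rewrite ?EM //; try by apply fr1.
  split=> //; rewrite /visited /dist_of /par_of ?EM ?E8' //;
    rewrite ?[reg s1 21]fr1.1 ?[bank s1 4]fr1.2 //.
  - by apply: frame_trans fr _; apply: frame_sub fr1.
  - by rewrite !fr1.1.
  - move=> u ru; case/markI => [Ey|]; last exact: lf.
    by move: ny; rewrite -Ey addKn; apply; lia.
  - exact: markS.
  - lia.
  - lia.
rewrite /visit; wp_step ltac:(rewrite ?E26 -?/y).
rewrite /= /upd /= -/y E7 E8; case: (ltnP y (3 * n.+1)) => Hy3.
  split=> //; apply: (other 3) => //; first lia.
  - by solve_frame.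
  - by rewrite /=; lia.
case: (ltnP y (4 * n.+1)) => Hy4; last first.
  split=> //; apply: (other 4) => //; first lia.
  - by solve_frame.
  - by rewrite /=; lia.
pose w := y - 3 * n.+1.
have Ey : y = 3 * n.+1 + w by lia.
(* The label of a second leaf makes [v] adjacent to every vertex below it, here [w] itself. *)
have Hvw : e v w.
  move: Fy; rewrite lab // /tree_label ifN; last lia.
  apply; first lia.
  by exists 0; rewrite /=; lia.
have /andP[_ rw] := He _ _ Hvw.
rewrite E3 -/w E26 -/(dist_of s0 s w).
do ![split; first by lia].
case: ltnP => Hdw; last first.
  split=> //; apply: (other 8) => //.
  - by solve_frame.
  - by rewrite /=; lia.
rewrite {other}.
have nw : ~~ visited s0 s w by rewrite /visited -leqNgt.
have ltD : dv <= reg s 21.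
  rewrite -Dv; have := bfs_bound bfs jqt; rewrite Qj.
  by lia.
have zl := zeros_leq (bank s 3) (reg s0 9).
rewrite E4 R23 R24.
do ![split; first by lia].
apply: HQ => //=.
have Ed u : 1 <= u <= n ->
    upd (upd (bank s 8) (reg s0 3 + w) dv.+1) (reg s0 3 + n.+1 + w) v (reg s0 3 + u) =
    upd (dist_of s0 s) w dv.+1 u.
  by move=> ru; rewrite /upd ifN ?eqn_add2l //; lia.
have Ep u : 1 <= u <= n ->
    upd (upd (bank s 8) (reg s0 3 + w) dv.+1) (reg s0 3 + n.+1 + w) v (reg s0 3 + n.+1 + u) =
    upd (par_of n s0 s) w v u.
  move=> ru; rewrite /upd eqn_add2l; case: eqP => // _; rewrite ifN //; lia.
split; rewrite /visited /dist_of /par_of /=.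
- by apply: frame_trans fr _; solve_frame.
- by [].
- have := bfs_inv_visit He bfs vv Hvw nw; rewrite Dv => /(_ mx).
  rewrite [upd _ 21 _ _]/upd /= addn1.
  apply: bfs_inv_ext => // u ru; rewrite Ed // Ep //; split=> //.
  by rewrite /upd; case: eqP.
- rewrite Ed // [upd _ 21 _ _]/upd /=; split=> //; first lia.
    by rewrite /upd ifN //; lia.
  by rewrite /upd ifN //; apply: contraNneq nw => <-.
- move=> u ru; rewrite Ed // /upd; case: eqP => // _; exact: mx.
- move=> u ru; rewrite Ed // {2}/upd; case: eqP => // nuw.
  by case/markI => [|/lf]; [rewrite Ey; lia|apply].
- exact: cl'.
- exact: root'.
- exact: markS.
- by rewrite -/M' /upd /=; lia.
- by rewrite -/M' /upd /=; lia.
Qed.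

Opaque visit.

Definition in_stack (s : state) (sp x : nat) : Prop :=
  exists2 i, i < sp & bank s 5 i = x.

(** With [sp] the stack height, the variant [2 * zeros + sp] drops at each pop, since the two pushes
    follow the marking of a node, which loses 2. The bound on [sp + 4 * zeros] prevents overflow of
    the stack pointer. Each stack entry carries 30 credits. *)
Lemma wp_explore V B n e src F s0 j v dv T s (Q : state -> Prop) :
  search_ctx V B n e src F s0 ->
  dfs_inv n e src s0 j v dv T (in_stack s (reg s 22)) (30 * reg s 22 + 1) s ->
  reg s 22 + 4 * zeros (bank s 3) (reg s0 9) <= 4 * reg s0 9 + 1 ->
  (forall i, i < reg s 22 ->
     bank s 5 i = 0 \/ F (bank s 5 i) v /\ bank s 5 i < reg s0 9) ->
  (forall s', dfs_inv n e src s0 j v dv T (fun=> False) 0 s' -> Q s') ->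
  wp V B explore Q s.
Proof.
move=> ctx inv0 Hsp0 Hst0 HQ.
have [EN E3N E4N E1 E0 Epar _ ok frN lab conn ltV He Hsrc] := ctx.
pose I k s' := [/\
  dfs_inv n e src s0 j v dv T (in_stack s' (reg s' 22)) (30 * reg s' 22 + 1) s',
  k = 2 * zeros (bank s' 3) (reg s0 9) + reg s' 22,
  reg s' 22 + 4 * zeros (bank s' 3) (reg s0 9) <= 4 * reg s0 9 + 1 &
  forall i, i < reg s' 22 ->
     bank s' 5 i = 0 \/ F (bank s' 5 i) v /\ bank s' 5 i < reg s0 9].
apply: (@wp_while _ _ _ _ _ _ I (2 * zeros (bank s 3) (reg s0 9) + reg s 22)) => //.
all: move=> k s1 {inv0 Hsp0 Hst0} [inv Ek Hsp Hst].
all: have fr1 := dfs_frame inv; rewrite (fr1.1 27) // E0.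
  move=> lt0.
  have E26 : reg s1 26 = 1 by rewrite fr1.1.
  have Esp : reg s1 22 = (reg s1 22).-1.+1 by lia.
  set sp := (reg s1 22).-1 in Esp; rewrite Esp in inv Ek Hsp Hst.
  do 3 wp_step ltac:(rewrite ?E26 ?Esp ?subn1 /=).
  set y := bank s1 5 sp; rewrite wp_ifE.
  set b := (_ < _); have {b}-> : b = (bank s1 3 y < 1) by rewrite /b /= /upd /= E26.
  have pop s2 x : bank s2 5 = bank s1 5 -> in_stack s1 sp.+1 x ->
      x = y \/ in_stack s2 sp x.
    move=> E5 [i lti Ei]; case: (i =P sp) => [Esp'|nsp].
      by left; rewrite -Ei Esp'.
    by right; exists i; [lia|rewrite E5].
  case: ltnP => My; last first.
    rewrite /nop /=; split=> //; set s2 := set_reg _ 16 _.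
    have fr12 : frame [:: 16; 17; 18; 19; 22] [:: 5] s1 s2 by solve_frame.
    exists k.-1; first lia.
    split; rewrite [reg s2 22]/= [bank s2 3]/= ?[bank s2 5]/= /upd /=.
    - apply: dfs_inv_frame inv => //=; last lia.
      by move=> x /(pop s2 x erefl)[->|]; [left|right].
    - lia.
    - lia.
    - by move=> i lti; apply: Hst; lia.
  set s2 := tick (set_reg _ 18 _).
  have fr12 : frame [:: 16; 17; 18; 19; 22] [:: 5] s1 s2 by solve_frame.
  have My0 : bank s1 3 y = 0 by lia.
  have [y0|[Fy lty]] := Hst sp (ltnSn _).
    by have := dfs_null inv; move: My0; rewrite /y y0 => ->.
  rewrite -/y in Fy lty.
  (* The popped entry gives 30 credits and the guard had 1 in reserve; 5 ticks were spent, so 26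
     remain. *)
  have inv2 : dfs_inv n e src s0 j v dv T (in_stack s1 sp.+1) (30 * sp + 26) s2.
    apply: dfs_inv_frame inv => //=; first by move=> x; right.
    lia.
  pose X x := in_stack s1 sp x \/ (x = bank s0 1 y \/ x = bank s0 2 y).
  rewrite wp_seqE; apply: (wp_visit (X' := X) ctx inv2) => //.
  - by move=> x /(pop s1 x erefl)[->|]; [left|right; left].
  - by right; left.
  - by right; right.
  move=> s3 inv3; rewrite [bank s2 3]/= => Ez E17 E22 E5.
  rewrite [reg s2 17]/= /upd /= in E17; rewrite [reg s2 22]/= /upd /= in E22.
  have fr3 := dfs_frame inv3.
  have EL : bank s3 1 = bank s0 1 by rewrite fr3.2.
  have ER : bank s3 2 = bank s0 2 by rewrite fr3.2.
  have E26' : reg s3 26 = 1 by rewrite fr3.1.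
  do 5 wp_step ltac:(rewrite ?E26' ?E17 ?E22 ?addn1 ?EL ?ER).
  split; rewrite /= /upd /= E26'; first lia.
  exists k.-1; first lia.
  set s4 := set_reg _ 22 _.
  have E22' : reg s4 22 = sp.+2 by rewrite /= /upd /= addn1.
  have E5' i : i < sp -> bank s4 5 i = bank s1 5 i.
    by move=> lti; rewrite /= /upd ifN ?ifN ?E5 //; lia.
  have E5L : bank s4 5 sp = bank s0 1 y by rewrite /= /upd eqxx ifN //; lia.
  have E5R : bank s4 5 sp.+1 = bank s0 2 y by rewrite /= /upd eqxx.
  have fr34 : frame [:: 16; 17; 18; 19; 22] [:: 5] s3 s4 by solve_frame.
  split; rewrite ?E22' ?[bank s4 3]/=.
  (* [26 + 48] credits less 6 ticks cover the two pushed entries and the next guard, [60 + 1]. *)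
  - apply: dfs_inv_frame inv3 => //=; last lia.
    move=> x [[i lti Ei]|[->|->]]; right.
    + by exists i; [lia|rewrite E5'].
    + by exists sp.
    + by exists sp.+1.
  - lia.
  - lia.
  - have [Llt Rlt] := graph_lt ok y.
    have sound z : z = bank s0 1 y \/ z = bank s0 2 y -> z = 0 \/ F z v.
      move=> Hz; case: (z =P 0) => [|z0]; [by left|right].
      exact: graph_sound ok v y z Fy z0 Hz.
    move=> i lti; case: (ltnP i sp) => Hi.
      by rewrite E5' //; apply: Hst; lia.
    have [->|->] : i = sp \/ i = sp.+1 by lia.
      by rewrite E5L; case: (sound _ (or_introl erefl)); [left|right].
    by rewrite E5R; case: (sound _ (or_intror erefl)); [left|right].
rewrite leqn0 => /eqP Esp; rewrite Esp in inv.
apply: HQ; have fr' : frame [:: 16; 17; 18; 19; 22] [:: 5] s1 (tick s1) by [].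
apply: dfs_inv_frame inv => //=; last lia.
by move=> x [].
Qed.

Opaque explore.

Lemma bfs_inv_next n (e : rel nat) src qt j q vis d par :
  bfs_inv n e src qt j q vis d par -> j < qt ->
  (forall w, e (q j) w -> vis w /\ d w <= (d (q j)).+1) ->
  bfs_inv n e src qt j.+1 q vis d par.
Proof.
case=> H1 H2 H3 H4 H5 H6 H7 H8 H9 H10 ltj Hj; split=> // i.
by rewrite ltnS leq_eqVlt => /predU1P[->|/H8].
Qed.

Lemma wp_search V B n e src F s0 (Q : state -> Prop) :
  search_ctx V B n e src F s0 -> reg s0 1 = src ->
  (forall x, bank s0 3 x = 0) ->
  (forall v, v <= n -> bank s0 8 (reg s0 3 + v) = 0) ->
  (forall s, frame search_regs search_banks s0 s ->
     search_inv n e src s0 (reg s 21) s ->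
     ticks s <= ticks s0 + 120 * reg s0 9 + 70 -> Q s) ->
  wp V B search Q s0.
Proof.
move=> ctx Es M0 D0 HQ.
have [EN E3N E4N E1 E0 Epar [raw1 raw2] ok frN lab conn ltV He Hsrc] := ctx.
set fr := reg s0 9 in ok frN ltV HQ.
do 6 wp_step ltac:(rewrite ?E1 ?E0 ?Es ?E3N ?addn0).
set s1 := set_bank _ 8 _ _.
(* 120 credits per node, 60 for the queue entry of the source, and the setup. In [T + 60 * j] the
   entries already dequeued give back their 60 credits, which pay for reading them and for the root
   on the stack. *)
pose T := ticks s0 + 120 * fr + 68.
pose I k s := exists j, [/\ reg s 20 = j /\ k = fr.+1 - j,
  frame search_regs search_banks s0 s, search_inv n e src s0 j s,
  [/\ forall x y, x <> 0 -> 0 < bank s 3 x -> y <> 0 ->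
       y = bank s0 1 x \/ y = bank s0 2 x -> 0 < bank s 3 y,
      0 < bank s 3 0 &
      forall u, 1 <= u <= n -> 0 < bank s 3 (3 * n.+1 + u) -> visited s0 s u] &
  [/\ reg s 21 + zeros (bank s 3) fr <= fr.+1,
      ticks s + 30 * (4 * zeros (bank s 3) fr + 2 * reg s 21) <= T + 60 * j &
      j < reg s 21 -> forall u, 1 <= u <= n -> visited s0 s u ->
        dist_of s0 s u <= (dist_of s0 s (bank s 4 j)).+1]].
apply: (@wp_while _ _ _ _ _ _ I fr.+1); last first.
- have E21 : reg s1 21 = 1 by [].
  have E20 : reg s1 20 = 0 by [].
  have zl := zeros_leq (bank s1 3) fr.
  have E3 x : 0 < bank s1 3 x -> x = 0.
    by rewrite /= /upd; case: eqP => //; rewrite M0.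
  have Ed v : v <= n -> dist_of s0 s1 v = (v == src).
    move=> rv; rewrite /dist_of /= /upd eqn_add2l; case: eqP => // _.
    by rewrite D0.
  exists 0; rewrite E21 E20; split.
  + by rewrite subn0.
  + by solve_frame.
  + have b0 : bfs_inv n e src 1 0 (bank s1 4) (eq_op^~ src) (dist_of s0 s1) (par_of n s0 s1).
      apply: bfs_inv_init => //; first by rewrite Ed ?eqxx //; lia.
      by move=> v rv nv; rewrite Ed ?(negbTE nv) //; lia.
    apply: bfs_inv_ext b0 => // v rv; rewrite /visited Ed; last lia.
    by split=> //; case: eqP.
  + split=> // [x y x0 /E3 //|u ru /E3]; lia.
  + have Et : ticks s1 = ticks s0 + 6 by rewrite /=; lia.
    split; [lia|rewrite /T; lia|].
    by move=> _ u ru _; rewrite Ed; [case: eqP|lia].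
- move=> k s [j [[E20 Ek] Hfr bfs _ [Hqt Ht _]]]; rewrite E20 => lej.
  have Ej : j = reg s 21 by have := bfs_jqt bfs; lia.
  rewrite Ej in bfs Ht; apply: HQ => //=; move: Ht; rewrite /T; lia.
move=> k s [j [[E20 Ek] Hfr bfs [cl null lf] [Hqt Ht mx]]]; rewrite E20 => ltj.
have zl := zeros_leq (bank s 3) fr.
have E26 : reg s 26 = 1 by rewrite Hfr.1.
have E27 : reg s 27 = 0 by rewrite Hfr.1.
have E3 : reg s 3 = reg s0 3 by rewrite Hfr.1.
have E5 : reg s 5 = n.+1 by rewrite Hfr.1.
set v := bank s 4 j in mx.
set dv := dist_of s0 s v in mx.
have [rv Vv] := bfs_queue bfs ltj; rewrite -/v in rv Vv.
have ltD : dv <= j.+1 by apply: bfs_bound bfs _ ltj.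
do 8 wp_step ltac:(rewrite ?E26 ?E27 ?E3 ?E5 ?E20 ?addn0 ?addn1 -?/v
  -?/(dist_of s0 s v) -?/dv).
set s2 := set_reg _ 22 1.
have E22 : reg s2 22 = 1 by [].
have E20' : reg s2 20 = j.+1 by [].
have inv2 : dfs_inv n e src s0 j v dv (T + 60 * j.+1) (in_stack s2 (reg s2 22))
    (30 * reg s2 22 + 1) s2.
  rewrite E22; split=> //.
  - by apply: frame_trans Hfr _; solve_frame.
  - exact: mx.
  - by move=> x y x0 Hx y0 Hy; left; apply: (cl x).
  - by right; exists 0; rewrite //= /upd /= addnC.
  - by rewrite -/fr /= /upd /=; lia.
apply: (wp_explore ctx inv2); rewrite ?E22.
- by rewrite [bank s2 3]/= -/fr; lia.
- case=> // _; right; rewrite /= /upd /= -/fr; split; last lia.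
  rewrite lab; last lia.
  rewrite /tree_label ifT; last lia.
  by split; [lia|rewrite addnC; apply: anc_refl].
move=> s3 [fr3 [R20 R23 R24] bfs3 [_ jqt Qj Dv] mx3 lf3 cl3 root3 null3 qt3 tk3].
exists (fr.+1 - j.+1); first lia.
have Vstep w : e v w -> visited s0 s3 w.
  move=> Hvw; have /andP[_ rw] := He _ _ Hvw.
  apply: lf3 => //.
  (* The marked nodes form a closed set containing the first leaf of [v], so [conn] puts the second
     leaf of each neighbour into it. *)
  pose P x := x <> 0 /\ 0 < bank s3 3 x.
  suff [] : P (3 * n.+1 + w) by [].
  apply: (conn v w Hvw P); last by split; [lia|case: root3].
  by move=> x y [x0 Hx] y0 Hy; split=> //; case: (cl3 x y x0 Hx y0 Hy).
exists j.+1; split=> //.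
- apply: bfs_inv_next bfs3 jqt _ => w; rewrite Qj Dv => Hvw.
  by split; [exact: Vstep|apply: mx3; [have /andP[]:= He _ _ Hvw|apply: Vstep]].
- split=> // x y x0 Hx y0 Hy.
  by case: (cl3 x y x0 Hx y0 Hy).
split=> //; first by rewrite -/fr addn0 in tk3.
(* The next queue entry is at least as far away as [v], so the bound carries over to it. *)
move=> ltj1 u ru Vu; apply: leq_trans (mx3 u ru Vu) _.
by rewrite ltnS -Dv -Qj; apply: (bfs_mono bfs3); lia.
Qed.

(* The complete program on the structured machine *)
Opaque copy_input build_trees add_bicliques search.

Definition main_cmd : cmd :=
  init_regs;; copy_input;; build_trees;; add_bicliques;; search.

Lemma input_memE n src bs x :
  input_mem n src bs (5 + x) =
  if (5 + x - 5) %/ 4 < size bs then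
    let c := nth (IBic 0 0 0 0) bs ((5 + x - 5) %/ 4) in
    match (5 + x - 5) %% 4 with
    | 0 => alo c | 1 => ahi c | 2 => blo c | _ => bhi c
    end
  else 0.
Proof. by []. Qed.

Lemma input_mem_biclique n src bs i :
  i < size bs -> let c := nth (IBic 0 0 0 0) bs i in
  [/\ input_mem n src bs (5 + 4 * i) = alo c,
      input_mem n src bs (5 + (4 * i + 1)) = ahi c,
      input_mem n src bs (5 + (4 * i + 2)) = blo c &
      input_mem n src bs (5 + (4 * i + 3)) = bhi c].
Proof.
move=> lti c; have E r : r < 4 -> input_mem n src bs (5 + (4 * i + r)) =
    match r with 0 => alo c | 1 => ahi c | 2 => blo c | _ => bhi c end.
  move=> ltr; rewrite input_memE.
  have -> : (5 + (4 * i + r) - 5) %/ 4 = i by lia.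
  have -> : (5 + (4 * i + r) - 5) %% 4 = r by lia.
  by rewrite lti.
by have := E 0 isT; rewrite addn0; split=> //; rewrite E.
Qed.

Lemma input_mem_out n src bs x : 5 + 4 * size bs <= x -> input_mem n src bs x = 0.
Proof.
move=> lex; rewrite (_ : x = 5 + (x - 5)) ?input_memE; last lia.
by rewrite ifN //; lia.
Qed.

Lemma input_mem_lt n src bs V x :
  (forall c, List.In c bs -> ibic_wf n c) -> src <= n -> n < V -> size bs < V ->
  input_mem n src bs x < V.
Proof.
move=> Hwf les ltn ltm; rewrite /input_mem.
do 4 (case: ifP => _; first lia).
case: (ltnP ((x - 5) %/ 4) (size bs)) => lti; last lia.
set c := nth _ _ _.
have : List.In c bs.
  rewrite /c; elim: bs (_ %/ 4) lti {Hwf ltm c} => // c bs IH [|i] /=; first by left.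
  by move=> lti; right; apply: IH.
case/Hwf=> /and5P[h1 h2 h3 h4 /andP[h5 h6]] _.
by case: (_ %% 4) => [|[|[|?]]]; lia.
Qed.

Lemma wp_main V n e bs src K s0 (Q : state -> Prop) :
  let m := size bs in let N := n.+1 in
  simple_graph_on n e -> interval_biclique_partition n e bs -> 1 <= src <= n ->
  2 * N <= 2 ^ K ->
  4 * (4 * N + m.+1 * (8 * K + 2)) + 4 * m + 2 * N + 100 < V ->
  [/\ reg s0 0 = n, reg s0 1 = src & reg s0 2 = m] ->
  (forall x, bank s0 8 x = input_mem n src bs x) ->
  (forall x, x < 36 -> bank s0 0 x = input_mem n src bs (5 + x)) ->
  (forall i x, 0 < i < 8 -> bank s0 i x = 0) ->
  (forall s, [/\ 41 <= reg s 3, reg s 3 + 2 * N <= 4 * m + 2 * n + 100 &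
       reg s 4 = reg s 3 + N] ->
     (forall v, 1 <= v <= n ->
        let d u := bank s 8 (reg s 3 + u) in
        let p := bank s 8 (reg s 4 + v) in
        (reachable e src v ->
           is_dist e src v (d v).-1 /\ 0 < d v /\
           (v != src -> e p v /\ is_dist e src p (d v).-2)) /\
        (~ reachable e src v -> d v = 0)) ->
     ticks s <= ticks s0 + 24 * m + 24 * N + m * (80 * K + 41)
                + 120 * (4 * N + m * (8 * K + 2)) + 100 -> Q s) ->
  wp V (4 * m + 2 * n + 100) main_cmd Q s0.
Proof.
move=> m N [He [sym _]] Hbs Hsrc leK HV [E0 E1 E2] Hraw Hinp Hzero HQ.
set B := 4 * m + 2 * n + 100.
rewrite /main_cmd /init_regs.
have NV : 4 * N < V by lia.
do 12 wp_step ltac:(rewrite ?E0 ?E1 ?E2 ?addn0 ?addn1 -/N).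
set s1 := set_reg _ 4 _.
have R1 : [/\ reg s1 26 = 1, reg s1 27 = 0, reg s1 5 = N, reg s1 6 = 2 * N &
    [/\ reg s1 7 = 3 * N, reg s1 8 = 4 * N, reg s1 9 = 4 * N, reg s1 11 = 4 * m &
    [/\ reg s1 1 = src, reg s1 3 = 4 * m + 46 & reg s1 4 = 4 * m + 46 + N]]].
  by split; last (split; last split); rewrite /= /upd /=; lia.
case: R1 => R26 R27 R5 R6 [R7 R8 R9 R11 [Rs R3 R4]].
have fr1 : frame [:: 3; 4; 5; 6; 7; 8; 9; 11; 16; 26; 27] [::] s0 s1 by solve_frame.
have t1 : ticks s1 = ticks s0 + 12 by rewrite /=; lia.
clearbody s1.
rewrite wp_seqE; apply: (wp_copy_input (m := m)) => //; try by lia.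
move=> s2 fr2 c1 c2 t2.
have Hin x : x < 4 * m -> bank s2 0 x = input_mem n src bs (5 + x).
  move=> ltx; case: (ltnP x 36) => Hx; first by rewrite c1 // fr1.2 // Hinp.
  by rewrite c2 ?Hx // fr1.2.
rewrite wp_seqE; apply: (@wp_build_trees _ _ _ N); rewrite ?fr2.1 //.
- by move=> x; rewrite fr2.2 // fr1.2 // Hzero.
- by move=> x; rewrite fr2.2 // fr1.2 // Hzero.
move=> s3 fr3 HL HR t3.
pose F := tree_label N e.
have r3 r : r \notin [:: 10; 16; 17] -> reg s3 r = reg s1 r.
  rewrite !inE !negb_or => /and3P[n1 n2 n3].
  by rewrite fr3.1 ?fr2.1 // !inE !negb_or ?n1 ?n2 ?n3.
have ctx3 : build_ctx N e F s3.
  split=> //; rewrite ?r3 ?R9 //.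
    exact: tree_graph_ok.
  exact: tree_graph_conn.
rewrite wp_seqE; apply: (wp_add_bicliques (bs := bs) (K := K) _ sym Hbs ctx3) => //.
- by rewrite r3.
- by rewrite r3 // R9 -/m; lia.
- by rewrite -/m; lia.
- move=> i lti c; rewrite fr3.2 //.
  have [h1 h2 h3 h4] := input_mem_biclique n src lti.
  by rewrite !Hin ?h1 ?h2 ?h3 ?h4 // /m; lia.
move=> F4 s4 [b26 b27 b5 b6 bok bfr btree blab] fr4 conn le4 t4.
have r4 r : r \notin [:: 9; 10; 12; 13; 14; 15; 16; 17; 18; 28; 29] ->
    reg s4 r = reg s1 r.
  move=> Hr; rewrite fr4.1 // r3 //; apply: contra Hr.
  by rewrite !inE; do ?[case: eqP => //= ?].
have bk4 i : 2 < i -> bank s4 i = bank s0 i.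
  move=> lti; rewrite fr4.2 ?fr3.2 ?fr2.2 ?fr1.2 // !inE; lia.
rewrite r3 // R9 in le4.
have sctx : search_ctx V B n e src F4 s4.
  split=> //; rewrite ?(r4 3) ?(r4 4) ?(r4 7) ?(r4 8) ?R3 ?R4 //.
  - rewrite /B; lia.
  - have : reg s4 9 <= 4 * N + m.+1 * (8 * K + 2) by rewrite mulSn; lia.
    rewrite -/N; lia.
apply: (wp_search sctx).
- by rewrite r4.
- by move=> x; rewrite bk4 // Hzero.
(* The distance array starts at [4m + 46], past the last input cell [4m + 4], so it is initially
   zero; the offset also exceeds 40 when [m = 0]. *)
- by move=> v lev; rewrite bk4 // r4 // R3 Hraw input_mem_out // -/m; lia.
move=> s5 fr5 bfs t5.
have E3 : reg s5 3 = reg s4 3 by rewrite fr5.1.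
have E4 : reg s5 4 = reg s4 3 + N by rewrite fr5.1 // !r4 // R3 R4.
apply: HQ.
- by rewrite E4 E3 r4 // R3; split=> //; lia.
- move=> v rv; rewrite E3 E4.
  exact: (bfs_inv_output He Hsrc bfs rv).
- rewrite -/m in t4; lia.
Qed.

Opaque main_cmd.

(** * The prelude: from the input layout to a simulated state *)

Lemma run_IConst W P k pc M a v cf : nth IHalt P pc = IConst a v -> v < W ->
  run W P k (pc.+1, upd M a v) = cf -> run W P k.+1 (pc, M) = cf.
Proof. by move=> H ltv; rewrite /= H ltv. Qed.

Lemma run_IAdd W P k pc M a b c cf : nth IHalt P pc = IAdd a b c -> M b + M c < W ->
  run W P k (pc.+1, upd M a (M b + M c)) = cf -> run W P k.+1 (pc, M) = cf.
Proof. by move=> H ltv; rewrite /= H ltv. Qed.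

Lemma run_ISub W P k pc M a b c cf : nth IHalt P pc = ISub a b c -> M b - M c < W ->
  run W P k (pc.+1, upd M a (M b - M c)) = cf -> run W P k.+1 (pc, M) = cf.
Proof. by move=> H ltv; rewrite /= H ltv. Qed.

Lemma run_IStore W P k pc M a b cf : nth IHalt P pc = IStore a b -> M b < W ->
  run W P k (pc.+1, upd M (M a) (M b)) = cf -> run W P k.+1 (pc, M) = cf.
Proof. by move=> H ltv; rewrite /= H ltv. Qed.

(* Only cells 3 and 4 are free at the start, so the input cells 5-40 must be
   moved to bank 0 before they can serve as registers. *)
Definition base_code : program :=
  [:: IAdd 3 2 2; IAdd 3 3 0; IAdd 3 3 3; IConst 4 100; IAdd 3 3 4; IConst 4 8].

Definition save_code (k : nat) : program :=
  flatten [seq [:: IStore 3 j; IAdd 3 3 4] | j <- iota 5 k].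

(** [288 = 8 * 36] is how far the pointer in cell 3 has moved while saving 36 cells; subtracting it
    recovers [B]. *)
Definition const_code : program :=
  [:: IConst 30 0; IConst 31 1; IConst 33 288; ISub 33 3 33].

Definition bank_code (k : nat) : program :=
  [seq IAdd (34 + i) (33 + i) 31 | i <- iota 0 k].

Definition prelude : program := base_code ++ save_code 36 ++ const_code ++ bank_code 7.

Definition bfs_program : program :=
  prelude ++ compile (size prelude) main_cmd ++ [:: IHalt].

Lemma save_codeS k : save_code k.+1 = save_code k ++ [:: IStore 3 (5 + k); IAdd 3 3 4].
Proof. by rewrite /save_code -[k.+1]addn1 iotaD map_cat flatten_cat. Qed.

Lemma size_save_code k : size (save_code k) = 2 * k.
Proof. by elim: k => // k IH; rewrite save_codeS size_cat IH /=; lia. Qed.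

(** Destinations start at [B >= 100], so no copy overwrites a cell among 5-40 that is still to be
    saved. *)
Lemma run_save_code W P pc B M k :
  k <= 36 -> M 3 = B -> M 4 = 8 -> 100 <= B -> B + 300 < W ->
  (forall x, 5 <= x <= 40 -> M x < W) -> code_at P pc (save_code k) ->
  exists M', [/\ run W P (2 * k) (pc, M) = Some (pc + 2 * k, M'),
    M' 3 = B + 8 * k,
    forall j, j < k -> M' (B + 8 * j) = M (5 + j) &
    forall x, x <> 3 -> (forall j, j < k -> x <> B + 8 * j) -> M' x = M x].
Proof.
move=> lek M3 M4 leB ltW HM.
elim: k lek => [|k IH] lek Hc.
  by exists M; split; rewrite ?addn0 ?muln0 ?addn0.
move: Hc; rewrite save_codeS => /code_at_cat[Hc1].
rewrite size_save_code => /code_at_cons[H1] /code_at_cons[H2] _.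
have [M' [R E3 E1 E2]] := IH (ltnW lek) Hc1.
have E4 : M' 4 = 8 by rewrite E2 // => j; lia.
have E5 : M' (5 + k) = M (5 + k) by apply: E2 => [|j]; lia.
have ltM : M (5 + k) < W by apply: HM; lia.
pose M1 := upd M' (B + 8 * k) (M (5 + k)).
have E13 : M1 3 = B + 8 * k by rewrite /M1 /upd; case: eqP => [?|//]; lia.
have E14 : M1 4 = 8 by rewrite /M1 /upd; case: eqP => [?|//]; lia.
exists (upd M1 3 (B + 8 * k + 8)); split.
- rewrite mulnS addnC; apply: run_add R _.
  apply: (run_IStore H1); rewrite E5 // E3 -/M1.
  apply: (run_IAdd H2); rewrite E13 E14 /=; first lia.
  by congr (Some (_, _)); lia.
- by rewrite /upd eqxx; lia.
- move=> j; rewrite ltnS leq_eqVlt => Hj.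
  rewrite /upd ifN; last lia.
  case/predU1P: Hj => [->|Hj]; first by rewrite /M1 /upd eqxx.
  by rewrite /M1 /upd ifN ?E1 //; lia.
- move=> x /eqP/negbTE nx3 nx; rewrite /upd nx3 /M1 /upd ifN; last by apply/eqP/nx.
  by apply: E2 => [|j ltj]; [apply/eqP; rewrite nx3|apply: nx; lia].
Qed.

Lemma run_const_code W P pc B M :
  M 3 = B + 288 -> B + 300 < W -> code_at P pc const_code ->
  exists M', [/\ run W P 4 (pc, M) = Some (4 + pc, M'),
    M' 30 = 0, M' 31 = 1, M' 33 = B &
    forall x, (x < 30) || (40 < x) -> M' x = M x].
Proof.
move=> M3 ltW; do 4 case/code_at_cons=> ?.
move=> _; eexists; split.
- do 3 (apply: run_IConst; [eassumption|lia|]).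
  by apply: run_ISub; [eassumption|rewrite /upd /= M3; lia|].
- by [].
- by [].
- by rewrite /upd /= M3; lia.
- by move=> x Hx; rewrite /upd; do ![rewrite ifN; last lia].
Qed.

Lemma run_bank_code W P pc B M k :
  k < 8 -> M 31 = 1 -> M 33 = B -> B + 8 < W -> code_at P pc (bank_code k) ->
  exists M', [/\ run W P k (pc, M) = Some (pc + k, M'),
    forall i, i <= k -> M' (33 + i) = B + i &
    forall x, (x < 33) || (40 < x) -> M' x = M x].
Proof.
move=> + M31 M33 ltW; elim: k => [|k IH] ltk Hc.
  by exists M; rewrite addn0; split=> // i; rewrite leqn0 => /eqP->; rewrite !addn0.
move: Hc; rewrite /bank_code -[k.+1]addn1 iotaD map_cat => /code_at_cat[Hc1].
rewrite size_map size_iota => /code_at_cons[H1] _.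
have [M' [R EM EM']] := IH (ltnW ltk) Hc1.
rewrite add0n in H1; have E := EM k (leqnn k).
have E31 : M' 31 = 1 by rewrite EM'.
exists (upd M' (34 + k) (B + k + 1)); split.
- apply: run_add R _; apply: (run_IAdd H1); rewrite E E31 /=; first lia.
  by congr (Some (_, _)); lia.
- move=> i lei; rewrite /upd; case: eqP => [Ei|ne]; first lia.
  by apply: EM; lia.
- by move=> x Hx; rewrite /upd ifN ?EM' //; lia.
Qed.

Lemma run_base_code W P n m M :
  M 0 = n -> M 2 = m -> 4 * m + 2 * n + 100 < W -> code_at P 0 base_code ->
  exists M', [/\ run W P 6 (0, M) = Some (6, M'),
    M' 3 = 4 * m + 2 * n + 100, M' 4 = 8 &
    forall x, x <> 3 -> x <> 4 -> M' x = M x].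
Proof.
move=> M0 M2 ltW; do 6 case/code_at_cons=> ?.
move=> _; eexists; split.
- do 3 (apply: run_IAdd; [eassumption|rewrite /upd /= M2 ?M0; lia|]).
  apply: run_IConst; [eassumption|lia|].
  apply: run_IAdd; [eassumption|rewrite /upd /= M2 ?M0; lia|].
  apply: run_IConst; [eassumption|lia|].
  by [].
- by rewrite /upd /= M2 M0; lia.
- by [].
- by move=> x /eqP/negbTE n3 /eqP/negbTE n4; rewrite /upd n3 n4.
Qed.

(** 89 is [6 + 72 + 4 + 7], the lengths of the four blocks of straight-line code. *)
Lemma run_prelude V W n e bs src :
  interval_biclique_partition n e bs -> 1 <= src <= n ->
  let B := 4 * size bs + 2 * n + 100 in
  B + 300 < V -> B + 8 * V + 8 <= W ->
  exists M s0, [/\ run W bfs_program 89 (0, input_mem n src bs) = Some (size prelude, M),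
    sim V B M s0,
    [/\ reg s0 0 = n, reg s0 1 = src, reg s0 2 = size bs & ticks s0 = 0],
    forall x, bank s0 8 x = input_mem n src bs x &
    (forall x, x < 36 -> bank s0 0 x = input_mem n src bs (5 + x)) /\
    (forall i x, 0 < i < 8 -> bank s0 i x = 0)].
Proof.
move=> [Hwf _] Hsrc B ltV leW.
set inp := input_mem n src bs.
have ltI x : inp x < V by apply: input_mem_lt => //; lia.
have Hc : code_at bfs_program 0
    (prelude ++ compile (size prelude) main_cmd ++ [:: IHalt]) by [].
have [/code_at_cat[c1 /code_at_cat[c2 /code_at_cat[c3 c4]]] _] := code_at_cat Hc.
have [M1 [R1 E3 E4 EM1]] := @run_base_code W _ n (size bs) inp erefl erefl
  (ltac:(lia)) c1.
have [||||M2 [R2 E3' E2 EM2]] := @run_save_code W _ 6 B M1 36 _ E3 E4 _ _ _ c2.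
- by [].
- lia.
- lia.
- by move=> x Hx; rewrite EM1; [have := ltI x; lia|lia|lia].
have [||M3' [R3' E30' E31' E33' EM3']] := @run_const_code W _ 78 B M2 _ _ c3.
- by rewrite E3'; lia.
- lia.
have [||M3 [R3 Ebase' EM3'']] := @run_bank_code W _ 82 B M3' 7 _ E31' E33' _ c4.
- by [].
- lia.
have E30 : M3 30 = 0 by rewrite EM3''.
have E31 : M3 31 = 1 by rewrite EM3''.
have Ebase i : i < 8 -> M3 (33 + i) = B + i by move=> lti; apply: Ebase'.
have EM3 x : (x < 30) || (40 < x) -> M3 x = M2 x.
  by move=> Hx; rewrite EM3'' ?EM3' //; lia.
have EM x : x <> 3 -> x <> 4 -> x < 30 \/ 40 < x < B -> M3 x = inp x.
  by move=> n3 n4 Hx; rewrite EM3 ?EM2 ?EM1 //; lia.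
have Ebk x : M3 (B + 8 * x) = if x < 36 then inp (5 + x) else 0.
  rewrite EM3; last lia.
  case: (ltnP x 36) => Hx; first by rewrite E2 // EM1 //; lia.
  rewrite EM2; [|lia|lia].
  by rewrite EM1; [apply: input_mem_out; lia|lia|lia].
have Ebk0 i x : 0 < i < 8 -> M3 (B + 8 * x + i) = 0.
  move=> Hi; rewrite EM3; last lia.
  rewrite EM2; [|lia|lia].
  by rewrite EM1; [apply: input_mem_out; lia|lia|lia].
(* Bank 8 can be the original input memory: [sim] compares it with the RAM only on [[41, B)], which
   the prelude leaves alone. *)
pose bk i x := if i == 8 then inp x else if i == 0 then
  if x < 36 then inp (5 + x) else 0 else 0.
exists M3, (State M3 bk 0); split=> //.
- apply: (run_add (k1 := 6) R1); apply: (run_add (k1 := 72) R2).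
  by apply: (run_add (k1 := 4) R3'); exact: R3.
- split=> //=.
  + move=> i x lti; rewrite /bk (_ : (i == 8) = false); last lia.
    by case: eqP => [->|ne]; [rewrite addn0 Ebk|rewrite Ebk0 //; lia].
  + by move=> x Hx; rewrite /bk /= EM //; lia.
  + move=> r ltr; case: (r =P 3) => [->|n3].
      by rewrite EM3 // E3'; lia.
    case: (r =P 4) => [->|n4]; last by rewrite EM; [exact: ltI| | |left].
    by rewrite EM3 // EM2 ?E4 //; lia.
  + move=> i x lti; rewrite /bk (_ : (i == 8) = false); last lia.
    by do 2 (case: ifP => _; [|lia]).
- by split; rewrite //= EM //; left.
- by split=> [x ltx|[|i] x Hi] //; rewrite /bk /=; [rewrite ltx|rewrite ifN //; lia].
Qed.

(** * Assembly and final bounds *)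

Lemma code_atE (P1 P2 P3 : program) : code_at (P1 ++ P2 ++ P3) (size P1) P2.
Proof.
have Hc : code_at (P1 ++ P2 ++ P3) 0 (P1 ++ P2 ++ P3) by [].
by have [_ /code_at_cat[H _]] := code_at_cat Hc.
Qed.

Theorem mainTheorem13 :
  exists (P : program) (c k : nat),
    forall (n : nat) (e : rel nat) (bs : seq ibic) (s : nat),
      simple_graph_on n e ->
      interval_biclique_partition n e bs ->
      1 <= s <= n ->
      exists M : memory,
        halts_within ((n + size bs + 2) ^ k) P (input_mem n s bs)
          (c * (n + size bs + 1) * (trunc_log 2 n + 1)) M /\
        correct_output n e s M.
Proof.
exists bfs_program, (150 * 200), 10 => n e bs src Hsimple Hbs Hsrc.
set m := size bs; set L := trunc_log 2 n + 1.
(* [K] bounds the number of tree levels. Program values stay below [X ^ 8] and RAM words below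
   [X ^ 10]; as [X >= 3], each spare exponent yields a factor 3, which absorbs the constants. *)
pose K := L.+1; set X := n + m + 2; pose V := X ^ 8.
have ltL : n < 2 ^ L by rewrite /L addn1; apply: trunc_log_ltn.
have leK : 2 * n.+1 <= 2 ^ K by rewrite /K expnS; lia.
have leL : L <= n.
  have /andP[leL _] := trunc_log_bounds (isT : 1 < 2) (ltac:(lia) : 0 < n).
  by rewrite /L addn1; apply: leq_trans (ltn_expl _ _) leL.
have leX2 : 3 * X <= X * X by rewrite leq_mul2r /X; lia.
have leX : 3 <= X by rewrite /X; lia.
have lepow a b : a <= b -> 3 ^ (b - a) * X ^ a <= X ^ b.
  move=> leab; rewrite -[X in _ <= _ ^ X](subnK leab) expnD leq_mul2r orbC.
  rewrite (leq_trans _ (_ : 3 ^ (b - a) <= X ^ (b - a))) //.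
  by case: (b - a) => // d; rewrite leq_exp2r.
have leX4 : 81 * (X * X) <= X ^ 6 by rewrite mulnn; apply: (lepow 2 6).
have leV : 9 * X ^ 6 <= V by apply: (lepow 6 8).
have leW : 9 * V <= X ^ 10 by apply: (lepow 8 10).
have HmK : m.+1 * (8 * K + 2) <= X * (8 * X + 2).
  by apply: leq_mul; rewrite /K /X; lia.
have EX : X * (8 * X + 2) = 8 * (X * X) + 2 * X by lia.
have HV : 4 * (4 * n.+1 + m.+1 * (8 * K + 2)) + 4 * m + 2 * n.+1 + 100 < V.
  have : n.+1 <= X by rewrite /X; lia.
  have : m <= X by rewrite /X; lia.
  have : 3 <= X by rewrite /X; lia.
  lia.
pose B := 4 * m + 2 * n + 100.
have leB : B + 308 < V by rewrite /B; move: leV leX4 leX2; rewrite /X; lia.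
have [||M0 [s0 [R0 S0 [E0 E1 E2 Et] Hraw [Hinp Hzero]]]] :=
  @run_prelude V (X ^ 10) n e bs src Hbs Hsrc.
- by rewrite -/m -/B; lia.
- by rewrite -/m -/B; lia.
rewrite -/m -/B in S0.
pose Q s := [/\ [/\ 41 <= reg s 3, reg s 3 + 2 * n.+1 <= B & reg s 4 = reg s 3 + n.+1],
   (forall v, 1 <= v <= n ->
      let d u := bank s 8 (reg s 3 + u) in
      let p := bank s 8 (reg s 4 + v) in
      (reachable e src v ->
         is_dist e src v (d v).-1 /\ 0 < d v /\
         (v != src -> e p v /\ is_dist e src p (d v).-2)) /\
      (~ reachable e src v -> d v = 0)) &
   ticks s <= 24 * m + 24 * n.+1 + m * (80 * K + 41)
              + 120 * (4 * n.+1 + m * (8 * K + 2)) + 100].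
have Hwp : wp V B main_cmd Q s0.
  apply: (wp_main Hsimple Hbs Hsrc leK HV) => // s H1 H2 H3.
  by split=> //; rewrite Et in H3.
have wf : cmd_wf main_cmd by [].
have [|||k [M [s1 [R1 S1 [[r3 r3' r4] Hout Ht] Htk]]]] :=
  @sim_cmd V B (X ^ 10) bfs_program main_cmd (size prelude) M0 s0 Q _ _ _ wf S0 Hwp.
- lia.
- by rewrite /B; lia.
- exact: code_atE.
have EM3 : M 3 = reg s1 3 by rewrite (sim_reg S1).
have EM4 : M 4 = reg s1 4 by rewrite (sim_reg S1).
exists M; split; last first.
  move=> v rv; have := Hout v rv.
  rewrite /= EM3 EM4 -!(sim_raw S1) //; rewrite ?r4; lia.
exists (89 + k), (size prelude + code_size main_cmd, M); split=> //.
(* The coefficients of [m * L], [m], [n.+1] and 1 in the tick bound sum to 2989; times 6 for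
   compilation, plus the 89 steps of the prelude, this stays below [150 * 200]. *)
- rewrite Et in Htk; set A := n + m + 1.
  have lemL : m * L <= A * L by rewrite leq_mul2r /A; lia.
  have leA : A <= A * L by rewrite leq_pmulr /L; lia.
  rewrite -mulnA; move: Ht; rewrite /K => Ht.
  have E1' : m * (80 * L.+1 + 41) = 80 * (m * L) + 121 * m by lia.
  have E2' : m * (8 * L.+1 + 2) = 8 * (m * L) + 10 * m by lia.
  rewrite E1' E2' in Ht.
  have lenA : n.+1 <= A by rewrite /A; lia.
  have lemA : m <= A by rewrite /A; lia.
  lia.
- exact: run_add R0 R1.
Qed.
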